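(* Let Assumption A hold and $z\in\mathbb C\setminus[0,\infty)$. If $w(z)\ne0$, then \[ \varphi(x,z)=\frac{w(z)}{2\sqrt{-p_0z}}\,a(x,z)^{-1}(1+o(1)),\qquad x\to\infty; \] if $w(z)=0$, then \[ \varphi(x,z)=-\{\varphi(\cdot,z),\xi(\cdot,z)\}\,a(x,z)(1+o(1)),\qquad x\to\infty . \]
   Context: Assumption A: $p>0$ absolutely continuous on $\mathbb R_+$, $p'\in L^1(\mathbb R_+)$, $p(x)\to p_0>0$; $q$ real, $q\in L^1(0,x_0)$, absolutely continuous on $[x_0,\infty)$, $q'\in L^1(x_0,\infty)$, $q(x)\to0$. $\varepsilon(x)=\int_x^\infty(|p'|+|q'|)dy$. $\omega=\sqrt{(q-z)/p}$, $\Re\omega>0$; $a(x,z)=\exp(-\int_0^x\omega\,dy)$. Modified Jost solution $\theta(x,z)$: the solution of $-(p\theta')'+q\theta=z\theta$ with $\theta(x,z)=a(x,z)(1+O(\varepsilon(x)))$ as $x\to\infty$ (for $z<0$ one fixes either boundary value $z\pm i0$ consistently for $\theta$ and $a$). Regular solution $\varphi(x,z)$: $\varphi(0,z)=0$, $\varphi'(0,z)=1$. Wronskian $\{f,g\}=p(x)(f'g-fg')$; $w(z)=\{\varphi(\cdot,z),\theta(\cdot,z)\}=p(0)\theta(0,z)$. $\xi(x,z)=\theta(x,z)\int_\varrho^x\theta(y,z)^{-2}p(y)^{-1}dy$, where $\theta(x,z)\ne0$ for $x\ge\varrho$, extended to $\mathbb R_+$ as a solution of the same equation. *)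

(* Defs.v *)
(* classical real analysis.  Complex numbers are pairs of reals;
   integrals are Henstock-Kurzweil (gauge) integrals, which allows L^1 data
   (absolutely gauge-integrable = Lebesgue integrable) without measure theory. *)
From Stdlib Require Import Reals Lra List ClassicalEpsilon.
Open Scope R_scope.

Definition Cplx := (R * R)%type.
Definition Cre (w : Cplx) : R := fst w.
Definition Cim (w : Cplx) : R := snd w.
Definition RtoC (r : R) : Cplx := (r, 0).
Definition Czero : Cplx := (0, 0).
Definition Cone : Cplx := (1, 0).
Definition Cadd (a b : Cplx) : Cplx := (fst a + fst b, snd a + snd b).
Definition Copp (a : Cplx) : Cplx := (- fst a, - snd a).
Definition Csub (a b : Cplx) : Cplx := Cadd a (Copp b).
Definition Cmul (a b : Cplx) : Cplx :=
  (fst a * fst b - snd a * snd b, fst a * snd b + snd a * fst b).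
Definition Cscal (r : R) (a : Cplx) : Cplx := (r * fst a, r * snd a).
Definition Cnorm (a : Cplx) : R := sqrt (fst a ^ 2 + snd a ^ 2).
Definition Cinv (a : Cplx) : Cplx :=
  (fst a / (fst a ^ 2 + snd a ^ 2), - snd a / (fst a ^ 2 + snd a ^ 2)).
Definition Cexp (a : Cplx) : Cplx := (exp (fst a) * cos (snd a), exp (fst a) * sin (snd a)).

(* principal square root: Re >= 0, cut along the negative real axis, where it
   returns +i sqrt|u| *)
Definition Csqrt (a : Cplx) : Cplx :=
  let r := Cnorm a in
  (sqrt ((r + fst a) / 2),
   if Rlt_dec (snd a) 0 then - sqrt ((r - fst a) / 2) else sqrt ((r - fst a) / 2)).

(* square root with Re > 0 off the cut; on the negative real axis (only reached
   when z < 0) the value is the boundary value: b = true  <-> z + i0 (value -i sqrt|u|),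
   b = false <-> z - i0 (value +i sqrt|u|). *)
Definition Csqrt_bv (b : bool) (a : Cplx) : Cplx :=
  if Rlt_dec (fst a) 0 then
    if Req_EM_T (snd a) 0 then (0, if b then - sqrt (- fst a) else sqrt (- fst a))
    else Csqrt a
  else Csqrt a.

(* a tagged division of [a,b] is a list of (tag, right endpoint) pairs *)
Fixpoint fine (delta : R -> R) (a b : R) (P : list (R * R)) : Prop :=
  match P with
  | nil => a = b
  | (t, x) :: P' => a < x /\ a <= t <= x /\ t - a < delta t /\ x - t < delta t
                    /\ fine delta x b P'
  end.

Fixpoint rsum (f : R -> R) (a : R) (P : list (R * R)) : R :=
  match P with
  | nil => 0
  | (t, x) :: P' => f t * (x - a) + rsum f x P'
  end.

Definition is_gint (f : R -> R) (a b I : R) : Prop :=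
  a <= b /\
  forall e, 0 < e -> exists delta : R -> R, (forall t, 0 < delta t) /\
    forall P, fine delta a b P -> Rabs (rsum f a P - I) < e.

Definition is_cgint (f : R -> Cplx) (a b : R) (I : Cplx) : Prop :=
  is_gint (fun t => fst (f t)) a b (fst I) /\ is_gint (fun t => snd (f t)) a b (snd I).

Definition cgint (f : R -> Cplx) (a b : R) : Cplx :=
  epsilon (inhabits Czero) (is_cgint f a b).

Definition L1_from (f : R -> R) (a : R) : Prop :=
  (forall b, a <= b -> exists I, is_gint f a b I) /\
  (forall b, a <= b -> exists I, is_gint (fun t => Rabs (f t)) a b I) /\
  (exists M, forall b I, a <= b -> is_gint (fun t => Rabs (f t)) a b I -> I <= M).

Definition improper_int (f : R -> R) (a L : R) : Prop :=
  forall e, 0 < e -> exists B, forall b I, B <= b -> is_gint f a b I -> Rabs (I - L) < e.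

Definition tends_to_inf (f : R -> R) (l : R) : Prop :=
  forall e, 0 < e -> exists X, forall x, X <= x -> Rabs (f x - l) < e.

Definition Ctends_to_inf (f : R -> Cplx) (l : Cplx) : Prop :=
  forall e, 0 < e -> exists X, forall x, X <= x -> Cnorm (Csub (f x) l) < e.

(* y1 is the quasi-derivative p y'; the equation is understood in the
   Caratheodory sense: y and p y' absolutely continuous, (p y')' = (q - z) y a.e. *)
Definition SL_sol (p q : R -> R) (z : Cplx) (y y1 : R -> Cplx) : Prop :=
  forall x, 0 <= x ->
    is_cgint (fun t => Cscal (/ p t) (y1 t)) 0 x (Csub (y x) (y 0)) /\
    is_cgint (fun t => Cmul (Csub (RtoC (q t)) z) (y t)) 0 x (Csub (y1 x) (y1 0)).

(* Wronskian {f,g} = p (f' g - f g') evaluated at x *)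
Definition wronsk (f f1 g g1 : R -> Cplx) (x : R) : Cplx :=
  Csub (Cmul (f1 x) (g x)) (Cmul (f x) (g1 x)).

Definition omega (b : bool) (p q : R -> R) (z : Cplx) (y : R) : Cplx :=
  Csqrt_bv b (Cscal (/ p y) (Csub (RtoC (q y)) z)).

Definition afun (b : bool) (p q : R -> R) (z : Cplx) (x : R) : Cplx :=
  Cexp (Copp (cgint (omega b p q z) 0 x)).

Definition epsf (pd qd : R -> R) (x : R) : R :=
  epsilon (inhabits 0) (improper_int (fun t => Rabs (pd t) + Rabs (qd t)) x).

Definition jost_asymp (b : bool) (p q pd qd : R -> R) (z : Cplx) (theta : R -> Cplx) : Prop :=
  exists K X, forall x, X <= x ->
    Cnorm (Csub (theta x) (afun b p q z x)) <= K * epsf pd qd x * Cnorm (afun b p q z x).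

(* Main.v *)
(* For any solution y, (y / theta)' = {y, theta} / (p theta^2) with a constant Wronskian.
   Hence h = a^2 phi / theta solves h' = - 2 omega h + w (a / theta)^2 / p, a linear equation
   whose damping tends to 2 sqrt(-z / p0) and whose forcing tends to w / p0; so h tends to
   w / (2 p0 sqrt(-z / p0)), which is the first asymptotics. If w = 0, then phi = C theta
   near infinity, and differentiating xi / theta gives {xi, theta} = 1, hence C = - {phi, xi}.
   The coefficients are only gauge integrable near 0, so the constancy of the Wronskian rests
   on the product rule for gauge primitives, a consequence of the Saks-Henstock lemma. *)

Require Import Defs.
From Stdlib Require Import Reals Lra List ClassicalEpsilon PropExtensionality FunctionalExtensionality.
From Coquelicot Require Import Rcomplements Rbar Hierarchy Continuity Derive RInt RInt_analysis ElemFct AutoDerive.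
From Coquelicot Require Complex.
Open Scope R_scope.
Set Bullet Behavior "Strict Subproofs".

(** The Jost estimate controls [theta] but says nothing about [theta1]. This is why everything goes
    through quotients by [theta]: their derivatives see the fluxes only inside a constant Wronskian.
    Subtracting the expected limit from h leaves a damped linear equation whose forcing tends to
    zero, and a Lyapunov function then replaces an explicit variation of constants. Two obstacles
    shape the rest. First, [afun] is built on [cgint], a chosen value that means something only if
    [omega] is integrable from 0. That is not among the data and is derived by contradiction from
    the Jost estimate itself. Second, the principal root jumps across its cut, so [omega] is first
    identified, for large x, with one continuous branch. The same branch gives sqrt(-p0 z) = p0
    sqrt(-z / p0), which turns the limit found for h into the stated constant. *)

(** * Sums over tagged divisions and the gauge integral *)

(** Here [h u t x] may be any function of an interval [u, x] and its tag t. Riemann sums are too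
    narrow, since the Saks-Henstock lemma and the product rule sum the local errors |f t (x - u) -
    (F x - F u)|. *)
Fixpoint hsum (h : R -> R -> R -> R) (a : R) (P : list (R * R)) : R :=
  match P with
  | nil => 0
  | (t, x) :: P' => h a t x + hsum h x P'
  end.

Lemma rsum_hsum f a P : rsum f a P = hsum (fun u t x => f t * (x - u)) a P.
Proof.
  revert a; induction P as [|[t x] P IH]; intros a; simpl; [reflexivity|].
  now rewrite IH.
Qed.

Lemma fine_le d a b P : fine d a b P -> a <= b.
Proof.
  revert a; induction P as [|[t x] P IH]; simpl; intros a H; [lra|].
  destruct H as (H1 & _ & _ & _ & H2). apply IH in H2. lra.
Qed.

Lemma fine_app d a c b P Q : fine d a c P -> fine d c b Q -> fine d a b (P ++ Q).
Proof.
  revert a; induction P as [|[t x] P IH]; simpl; intros a H HQ.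
  - now subst.
  - decompose [and] H. repeat split; auto.
Qed.

Lemma hsum_app d h a c b P Q : fine d a c P -> fine d c b Q ->
  hsum h a (P ++ Q) = hsum h a P + hsum h c Q.
Proof.
  revert a; induction P as [|[t x] P IH]; simpl; intros a H HQ.
  - subst; lra.
  - decompose [and] H. rewrite (IH x); auto. lra.
Qed.

Lemma rsum_app d f a c b P Q : fine d a c P -> fine d c b Q ->
  rsum f a (P ++ Q) = rsum f a P + rsum f c Q.
Proof. rewrite !rsum_hsum. apply hsum_app. Qed.

Lemma fine_mono d1 d2 a b P :
  (forall t, d1 t <= d2 t) -> fine d1 a b P -> fine d2 a b P.
Proof.
  intros Hd; revert a; induction P as [|[t x] P IH]; simpl; intros a H; auto.
  decompose [and] H. specialize (Hd t). repeat split; auto; lra.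
Qed.

Definition gmin (d1 d2 : R -> R) (t : R) : R := Rmin (d1 t) (d2 t).

Lemma gmin_pos d1 d2 :
  (forall t, 0 < d1 t) -> (forall t, 0 < d2 t) -> forall t, 0 < gmin d1 d2 t.
Proof. intros H1 H2 t; apply Rmin_pos; auto. Qed.

Lemma fine_gmin_l d1 d2 a b P : fine (gmin d1 d2) a b P -> fine d1 a b P.
Proof. apply fine_mono; intros t; apply Rmin_l. Qed.

Lemma fine_gmin_r d1 d2 a b P : fine (gmin d1 d2) a b P -> fine d2 a b P.
Proof. apply fine_mono; intros t; apply Rmin_r. Qed.

(** Cousin's lemma, without which [is_gint] could hold vacuously. The supremum s of the reachable
    endpoints can serve as a tag, and the interval tagged by s would reach beyond s unless b stops
    it. *)
Lemma cousin d a b : (forall t, 0 < d t) -> a <= b -> exists P, fine d a b P.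
Proof.
  intros Hd Hab.
  set (S := fun x => x <= b /\ exists P, fine d a x P).
  assert (HSa : S a) by (split; [lra|exists nil; reflexivity]).
  destruct (completeness S) as [s [Hub Hlub]].
  - exists b; intros x [H _]; exact H.
  - now exists a.
  - assert (Hx : exists x, S x /\ s - d s < x).
    { apply NNPP; intros HN.
      assert (s <= s - d s); [|specialize (Hd s); lra].
      apply Hlub; intros x Hx. apply Rnot_lt_le; intros Hlt. apply HN; eauto. }
    destruct Hx as [x [Hx Hxs]].
    assert (Hx' := Hub x Hx). destruct Hx as [Hxb [P HP]].
    assert (Hsb : s <= b) by (apply Hlub; intros y [H _]; exact H).
    specialize (Hd s).
    set (y := Rmin b (s + d s / 2)).
    assert (Hy : (y = b /\ b <= s + d s / 2) \/ (y = s + d s / 2 /\ s + d s /2 <= b))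
      by (unfold y, Rmin; destruct (Rle_dec b (s + d s / 2)); lra).
    assert (HSy : S y).
    { split; [lra|]. destruct (Rle_lt_dec y x) as [Hyx|Hyx].
      - assert (y = x) by lra. rewrite H. eauto.
      - exists (P ++ (s, y) :: nil). eapply fine_app; [exact HP|].
        simpl. repeat split; lra. }
    assert (y <= s) by (apply Hub; exact HSy).
    assert (y = b) by lra.
    destruct HSy as [_ HQ]. now rewrite H0 in HQ.
Qed.

(** The premise hands the fineness bounds to each term, so that estimates valid only within the
    gauge can be used interval by interval. *)
Lemma hsum_le d h k a b P :
  (forall u t x, a <= u -> u < x -> x <= b -> u <= t <= x ->
     t - u < d t -> x - t < d t -> h u t x <= k u t x) ->
  fine d a b P -> hsum h a P <= hsum k a P.
Proof.
  revert a; induction P as [|[t x] P IH]; simpl; intros a Hhk H; [lra|].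
  decompose [and] H.
  assert (x <= b) by (eapply fine_le; eauto).
  apply Rplus_le_compat.
  - apply Hhk; auto; lra.
  - apply IH; auto. intros; apply Hhk; auto; lra.
Qed.

Lemma hsum_eq h k a P : (forall u t x, h u t x = k u t x) -> hsum h a P = hsum k a P.
Proof.
  intros H; revert a; induction P as [|[t x] P IH]; simpl; intros a; [reflexivity|].
  now rewrite H, IH.
Qed.

Lemma hsum_plus h k a P :
  hsum (fun u t x => h u t x + k u t x) a P = hsum h a P + hsum k a P.
Proof.
  revert a; induction P as [|[t x] P IH]; simpl; intros a; [lra|]. rewrite IH; lra.
Qed.

Lemma hsum_scal c h a P : hsum (fun u t x => c * h u t x) a P = c * hsum h a P.
Proof.
  revert a; induction P as [|[t x] P IH]; simpl; intros a; [lra|]. rewrite IH; lra.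
Qed.

Lemma hsum_abs h a P : Rabs (hsum h a P) <= hsum (fun u t x => Rabs (h u t x)) a P.
Proof.
  revert a; induction P as [|[t x] P IH]; simpl; intros a.
  - rewrite Rabs_R0; lra.
  - eapply Rle_trans; [apply Rabs_triang|]. specialize (IH x). lra.
Qed.

Lemma hsum_nonneg h a P : (forall u t x, 0 <= h u t x) -> 0 <= hsum h a P.
Proof.
  intros H; revert a; induction P as [|[t x] P IH]; simpl; intros a; [lra|].
  specialize (H a t x); specialize (IH x); lra.
Qed.

Lemma hsum_telescope d (F : R -> R) a b P :
  fine d a b P -> hsum (fun u _ x => F x - F u) a P = F b - F a.
Proof.
  revert a; induction P as [|[t x] P IH]; simpl; intros a H.
  - subst; lra.
  - decompose [and] H. rewrite IH; auto. lra.
Qed.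

(** The converse of the Saks-Henstock lemma: F b - F a telescopes over the division, so the error of
    the Riemann sum is at most the sum of the local errors. *)
Lemma gint_gauge_close f a b I F :
  F b - F a = I -> a <= b ->
  (forall e, 0 < e -> exists d, (forall t, 0 < d t) /\
     forall P, fine d a b P -> hsum (fun u t x => Rabs (f t * (x - u) - (F x - F u))) a P <= e) ->
  is_gint f a b I.
Proof.
  intros HI Hab H; split; auto. intros e He.
  destruct (H (e / 2)) as [d [Hd HP]]; [lra|].
  exists d; split; auto. intros P HfP.
  rewrite <- HI, <- (hsum_telescope _ F _ _ _ HfP), rsum_hsum.
  specialize (HP P HfP).
  apply Rle_lt_trans with (e / 2); [|lra].
  eapply Rle_trans; [|exact HP].
  eapply Rle_trans; [|apply hsum_abs].
  right. f_equal.
  rewrite (hsum_eq (fun u t x => f t * (x - u) - (F x - F u))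
            (fun u t x => f t * (x - u) + (-1) * (F x - F u))) by (intros; lra).
  rewrite hsum_plus, hsum_scal. lra.
Qed.

Lemma Rabs_le_all_eq_0 x : (forall e, 0 < e -> Rabs x <= e) -> x = 0.
Proof.
  intros H. destruct (Req_dec x 0) as [|Hx]; auto.
  apply Rabs_pos_lt in Hx. specialize (H (Rabs x / 2)). lra.
Qed.

Lemma is_gint_unique f a b I J : is_gint f a b I -> is_gint f a b J -> I = J.
Proof.
  intros [Hab HI] [_ HJ].
  cut (I - J = 0); [lra|]. apply Rabs_le_all_eq_0; intros e He.
  destruct (HI (e/2)) as [d1 [Hd1 H1]]; [lra|].
  destruct (HJ (e/2)) as [d2 [Hd2 H2]]; [lra|].
  destruct (cousin (gmin d1 d2) a b) as [P HP]; auto using gmin_pos.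
  specialize (H1 P (fine_gmin_l _ _ _ _ _ HP)).
  specialize (H2 P (fine_gmin_r _ _ _ _ _ HP)).
  apply Rabs_def2 in H1; apply Rabs_def2 in H2. apply Rabs_le; lra.
Qed.

(** Every fine division of [x, y] is prefixed by one fixed division of [a, x] that is fine for both
    gauges, and each integral contributes e/2. *)
Lemma is_gint_diff f a x y I J :
  x <= y -> is_gint f a x I -> is_gint f a y J -> is_gint f x y (J - I).
Proof.
  intros Hxy [Hax HI] [_ HJ]; split; auto. intros e He.
  destruct (HI (e/2)) as [d1 [Hd1 H1]]; [lra|].
  destruct (HJ (e/2)) as [d2 [Hd2 H2]]; [lra|].
  destruct (cousin (gmin d1 d2) a x) as [Q HQ]; auto using gmin_pos.
  exists d2; split; auto. intros P HP.
  specialize (H1 Q (fine_gmin_l _ _ _ _ _ HQ)).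
  apply fine_gmin_r in HQ.
  specialize (H2 _ (fine_app _ _ _ _ _ _ HQ HP)).
  rewrite (rsum_app d2 f a x y) in H2 by auto.
  apply Rabs_def2 in H1; apply Rabs_def2 in H2. apply Rabs_def1; lra.
Qed.

(** Appending a common division of [x, y] transfers the Cauchy criterion from [a, y] to [a, x]. The
    integral is then the supremum of [E], the numbers that bound all sufficiently fine sums from
    below, that is, the lower limit of the sums along gauges. *)
Lemma ex_gint_initial f a x y J :
  a <= x <= y -> is_gint f a y J -> exists I, is_gint f a x I.
Proof.
  intros [Hax Hxy] [_ HJ].
  assert (HC : forall e, 0 < e -> exists d, (forall t, 0 < d t) /\
            forall P Q, fine d a x P -> fine d a x Q -> rsum f a P <= rsum f a Q + e).
  { intros e He. destruct (HJ (e/2)) as [d [Hd H]]; [lra|].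
    exists d; split; auto. intros P Q HP HQ.
    destruct (cousin d x y) as [T HT]; auto.
    assert (H1 := H _ (fine_app _ _ _ _ _ _ HP HT)).
    assert (H2 := H _ (fine_app _ _ _ _ _ _ HQ HT)).
    rewrite (rsum_app d f a x y) in H1, H2 by auto.
    apply Rabs_def2 in H1; apply Rabs_def2 in H2. lra. }
  set (E := fun r => exists d, (forall t, 0 < d t) /\ forall P, fine d a x P -> r <= rsum f a P).
  assert (HE : forall e, 0 < e -> exists d, (forall t, 0 < d t) /\
            forall P, fine d a x P -> E (rsum f a P - e) /\ is_upper_bound E (rsum f a P + e)).
  { intros e He. destruct (HC e He) as [d [Hd H]]. exists d; split; auto.
    intros P HP; split.
    - exists d; split; auto. intros Q HQ. specialize (H P Q HP HQ). lra.
    - intros r [d' [Hd' Hr]].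
      destruct (cousin (gmin d d') a x) as [Q HQ]; auto using gmin_pos.
      specialize (Hr Q (fine_gmin_r _ _ _ _ _ HQ)).
      specialize (H Q P (fine_gmin_l _ _ _ _ _ HQ) HP). lra. }
  destruct (completeness E) as [I [Hub Hlub]].
  - destruct (HE 1) as [d [Hd H]]; [lra|]. destruct (cousin d a x) as [P HP]; auto.
    exists (rsum f a P + 1). apply H; auto.
  - destruct (HE 1) as [d [Hd H]]; [lra|]. destruct (cousin d a x) as [P HP]; auto.
    exists (rsum f a P - 1). apply H; auto.
  - exists I; split; auto. intros e He.
    destruct (HE (e/2)) as [d [Hd H]]; [lra|]. exists d; split; auto.
    intros P HP. destruct (H P HP) as [H1 H2].
    apply Hub in H1. apply Hlub in H2. apply Rabs_def1; lra.
Qed.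

Lemma is_gint_ext f g a b I :
  (forall t, a <= t <= b -> f t = g t) -> is_gint f a b I -> is_gint g a b I.
Proof.
  intros Hfg [Hab H]; split; auto. intros e He.
  destruct (H e He) as [d [Hd HP]]. exists d; split; auto.
  intros P HfP. replace (rsum g a P) with (rsum f a P); auto.
  rewrite !rsum_hsum.
  apply Rle_antisym; (eapply hsum_le; [|exact HfP]); intros; rewrite Hfg by lra; lra.
Qed.

Lemma is_gint_plus f g a b I J :
  is_gint f a b I -> is_gint g a b J -> is_gint (fun t => f t + g t) a b (I + J).
Proof.
  intros [Hab HI] [_ HJ]; split; auto. intros e He.
  destruct (HI (e/2)) as [d1 [Hd1 H1]]; [lra|].
  destruct (HJ (e/2)) as [d2 [Hd2 H2]]; [lra|].
  exists (gmin d1 d2); split; [auto using gmin_pos|]. intros P HP.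
  specialize (H1 P (fine_gmin_l _ _ _ _ _ HP)).
  specialize (H2 P (fine_gmin_r _ _ _ _ _ HP)).
  rewrite !rsum_hsum in *.
  rewrite (hsum_eq _ (fun u t x => f t * (x - u) + g t * (x - u))) by (intros; lra).
  rewrite hsum_plus.
  apply Rabs_def2 in H1; apply Rabs_def2 in H2. apply Rabs_def1; lra.
Qed.

Lemma is_gint_opp f a b I : is_gint f a b I -> is_gint (fun t => - f t) a b (- I).
Proof.
  intros [Hab HI]; split; auto. intros e He.
  destruct (HI e He) as [d [Hd H]]. exists d; split; auto. intros P HP.
  specialize (H P HP). rewrite rsum_hsum in *.
  rewrite (hsum_eq _ (fun u t x => (-1) * (f t * (x - u)))) by (intros; lra).
  rewrite hsum_scal. apply Rabs_def2 in H. apply Rabs_def1; lra.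
Qed.

Lemma is_gint_bound f a b I m M :
  (forall t, a <= t <= b -> m <= f t <= M) -> is_gint f a b I ->
  m * (b - a) <= I <= M * (b - a).
Proof.
  intros Hf [Hab HI].
  assert (H : forall e, 0 < e -> m * (b - a) - e <= I <= M * (b - a) + e).
  { intros e He. destruct (HI e He) as [d [Hd H]].
    destruct (cousin d a b) as [P HP]; auto.
    specialize (H P HP). rewrite rsum_hsum in H. apply Rabs_def2 in H.
    assert (Hc : forall c, hsum (fun u t x => c * (x - u)) a P = c * (b - a)).
    { intros c. rewrite hsum_scal. f_equal.
      apply (hsum_telescope d (fun x => x)); auto. }
    assert (m * (b - a) <= hsum (fun u t x => f t * (x - u)) a P).
    { rewrite <- Hc. eapply hsum_le; [|exact HP].
      intros. apply Rmult_le_compat_r; [lra|apply Hf; lra]. }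
    assert (hsum (fun u t x => f t * (x - u)) a P <= M * (b - a)).
    { rewrite <- Hc. eapply hsum_le; [|exact HP].
      intros. apply Rmult_le_compat_r; [lra|apply Hf; lra]. }
    lra. }
  split; apply Rnot_lt_le; intros Hlt.
  - specialize (H ((m * (b - a) - I) / 2)). lra.
  - specialize (H ((I - M * (b - a)) / 2)). lra.
Qed.

(** The estimate of the total error passes to any selection of intervals of one division, because
    the error on the other intervals can be made arbitrarily small. Selecting the intervals by the
    sign of their error then yields absolute values, at the cost of doubling e/2. *)
Lemma saks_henstock f F a b :
  a <= b -> (forall x, a <= x -> is_gint f a x (F x - F a)) ->
  forall e, 0 < e -> exists d, (forall t, 0 < d t) /\
    forall P, fine d a b P ->
      hsum (fun u t x => Rabs (f t * (x - u) - (F x - F u))) a P <= e.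
Proof.
  intros Hab HF e He.
  destruct (HF b) as [_ Hb]; auto.
  destruct (Hb (e / 2)) as [d [Hd HP]]; [lra|]. exists d; split; auto.
  set (g := fun u t x => f t * (x - u) - (F x - F u)).
  (* The intervals rejected by [sel] are refined until their Riemann sums are exact up to [eta]. *)
  assert (Hrefine : forall (sel : R -> R -> R -> bool) eta, 0 < eta -> forall P c,
            a <= c -> fine d c b P -> exists P', fine d c b P' /\
              Rabs (rsum f c P' - (F b - F c)
                    - hsum (fun u t x => if sel u t x then g u t x else 0) c P)
              <= eta * INR (length P)).
  { intros sel eta Heta P. induction P as [|[t x] P IH]; intros c Hac HfP.
    - exists nil; split; auto. simpl in *. subst. rewrite Rabs_pos_eq; lra.
    - simpl in HfP. destruct HfP as (Hcx & Htx & Ht1 & Ht2 & HfP).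
      destruct (IH x) as [P' [HP' HS]]; [lra|auto|].
      cbn [hsum length]. rewrite S_INR.
      destruct (sel c t x).
      + exists ((t, x) :: P'); split; [simpl; tauto|]. simpl rsum. unfold g at 1.
        match goal with |- Rabs ?A <= _ => match type of HS with Rabs ?B <= _ =>
          replace A with B by ring end end.
        lra.
      + assert (Hi : is_gint f c x (F x - F c)).
        { replace (F x - F c) with ((F x - F a) - (F c - F a)) by ring.
          apply is_gint_diff with a; [lra|apply HF; lra|apply HF; lra]. }
        destruct Hi as [_ Hi]. destruct (Hi eta Heta) as [d' [Hd' Hi']].
        destruct (cousin (gmin d d') c x) as [Q HQ]; [auto using gmin_pos|lra|].
        specialize (Hi' Q (fine_gmin_r _ _ _ _ _ HQ)). apply fine_gmin_l in HQ.
        exists (Q ++ P'); split; [eapply fine_app; eauto|].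
        rewrite (rsum_app d f c x b) by auto.
        apply Rabs_def2 in Hi'. apply Rabs_le_between in HS.
        apply Rabs_le. lra. }
  assert (Hsel : forall (sel : R -> R -> R -> bool) P, fine d a b P ->
            Rabs (hsum (fun u t x => if sel u t x then g u t x else 0) a P) <= e / 2).
  { intros sel P HfP. apply Rnot_lt_le; intros Hlt.
    set (T := hsum (fun u t x => if sel u t x then g u t x else 0) a P) in *.
    assert (Hn := pos_INR (length P)).
    (* With this [eta] the refined intervals together consume at most half of the supposed excess
       |T| - e/2. The added 1 keeps the denominator positive for an empty division. *)
    set (eta := (Rabs T - e / 2) / (2 * (INR (length P) + 1))).
    assert (Heta : 0 < eta) by (apply Rdiv_lt_0_compat; lra).
    destruct (Hrefine sel eta Heta P a) as [P' [HP' HS]]; [lra|auto|].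
    specialize (HP P' HP'). fold T in HS.
    assert (eta * INR (length P) <= (Rabs T - e / 2) / 2).
    { apply Rle_trans with (eta * (INR (length P) + 1)).
      - apply Rmult_le_compat_l; lra.
      - right. unfold eta. field. lra. }
    revert HP HS Hlt H. unfold Rabs. repeat destruct Rcase_abs; lra. }
  intros P HfP.
  (* [s] selects the nonnegative errors and its negation the negative ones. *)
  set (s := fun u t x : R => if Rle_dec 0 (g u t x) then true else false).
  assert (H1 := Hsel s P HfP).
  assert (H2 := Hsel (fun u t x => negb (s u t x)) P HfP).
  rewrite (hsum_eq _ (fun u t x => (if s u t x then g u t x else 0)
                     + (-1) * (if negb (s u t x) then g u t x else 0))).
  - rewrite hsum_plus, hsum_scal.
    apply Rabs_le_between in H1. apply Rabs_le_between in H2. lra.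
  - intros u t x. fold (g u t x). unfold s. destruct Rle_dec; simpl.
    + rewrite Rabs_pos_eq; lra.
    + rewrite Rabs_left; lra.
Qed.

(** * Continuity and gauge primitives on a half-line *)

(** Clamping the argument extends f to the left of a by its value at a, so one-sided continuity at a
    becomes two-sided continuity, to which the filter lemmas apply. *)
Definition cont_from (a : R) (f : R -> R) : Prop :=
  forall x, continuous (fun y => f (Rmax a y)) x.

Lemma cont_fromP a f :
  cont_from a f <->
  forall x, a <= x -> forall e, 0 < e ->
    exists d, 0 < d /\ forall y, a <= y -> Rabs (y - x) < d -> Rabs (f y - f x) < e.
Proof.
  split.
  - intros H x Hx e He.
    specialize (H x). apply continuity_pt_filterlim in H.
    destruct (H e He) as [d [Hd H']]. exists d; split; [exact Hd|].
    intros y Hy Hyx.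
    destruct (Req_dec y x) as [->|Hne].
    { rewrite Rminus_diag, Rabs_R0; exact He. }
    specialize (H' y). simpl in H'. unfold R_dist, D_x, no_cond in H'.
    rewrite !Rmax_right in H' by lra. apply H'. repeat split; auto.
  - intros H x. apply continuity_pt_filterlim. intros e He.
    assert (Hm : a <= Rmax a x) by apply Rmax_l.
    destruct (H _ Hm e He) as [d [Hd H']]. exists d; split; [exact Hd|].
    simpl. unfold R_dist. intros y [_ Hyx]. apply H'; [apply Rmax_l|].
    eapply Rle_lt_trans; [|exact Hyx].
    unfold Rmax; repeat destruct Rle_dec; unfold Rabs; repeat destruct Rcase_abs; lra.
Qed.

Lemma cont_from_weaken a b f : a <= b -> cont_from a f -> cont_from b f.
Proof.
  rewrite !cont_fromP. intros Hab H x Hx e He.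
  destruct (H x) with (e := e) as [d [Hd H']]; [lra|auto|].
  exists d; split; auto. intros y Hy; apply H'; lra.
Qed.

Lemma cont_from_bounded a f b :
  a <= b -> cont_from a f -> exists M, 0 <= M /\ forall t, a <= t <= b -> Rabs (f t) <= M.
Proof.
  intros Hab H.
  destruct (continuity_ab_maj (fun y => Rabs (f (Rmax a y))) a b Hab) as [m [Hm Hmab]].
  { intros c Hc. apply continuity_pt_filterlim.
    apply (continuous_comp (fun y => f (Rmax a y)) Rabs); [apply H|apply continuous_Rabs]. }
  exists (Rabs (f (Rmax a m))); split; [apply Rabs_pos|].
  intros t Ht. specialize (Hm t Ht). cbv beta in Hm. rewrite (Rmax_right a t) in Hm by lra. exact Hm.
Qed.

Definition primitive_from (a : R) (f F : R -> R) : Prop :=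
  forall x, a <= x -> is_gint f a x (F x - F a).

Lemma primitive_from_gint a f F x y :
  primitive_from a f F -> a <= x -> x <= y -> is_gint f x y (F y - F x).
Proof.
  intros H Hax Hxy.
  replace (F y - F x) with ((F y - F a) - (F x - F a)) by ring.
  apply is_gint_diff with a; [auto|apply H; lra|apply H; lra].
Qed.

Lemma primitive_from_weaken a b f F :
  primitive_from a f F -> a <= b -> primitive_from b f F.
Proof. intros H Hab x Hx. apply primitive_from_gint with a; auto. Qed.

(** The interval [u, x] with tag c is made one term of a fine division of [a, c + 1]. All
    Saks-Henstock terms are nonnegative, so this one alone is at most e. The endpoint c + 1 leaves
    room to the right of c. *)
Lemma primitive_from_small_increment a f F c :
  primitive_from a f F -> a <= c -> forall e, 0 < e ->
  exists d, 0 < d /\ forall u x, a <= u -> u <= c <= x -> c - u < d -> x - c < d ->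
    Rabs (f c * (x - u) - (F x - F u)) <= e.
Proof.
  intros H Hac e He.
  destruct (saks_henstock f F a (c + 1)) with (e := e) as [d [Hd HP]]; [lra|exact H|exact He|].
  exists (Rmin (d c) 1); split; [apply Rmin_pos; auto; lra|].
  intros u x Hu Hc H1 H2.
  assert (Hm1 := Rmin_l (d c) 1). assert (Hm2 := Rmin_r (d c) 1).
  destruct (Req_dec u x) as [Hux|Hux].
  { subst. rewrite !Rminus_diag, Rmult_0_r, Rminus_diag, Rabs_R0. lra. }
  destruct (cousin d a u) as [P1 HP1]; auto.
  destruct (cousin d x (c + 1)) as [P2 HP2]; [auto|lra|].
  assert (HQ : fine d u (c + 1) ((c, x) :: P2)) by (simpl; repeat split; auto; lra).
  specialize (HP _ (fine_app _ _ _ _ _ _ HP1 HQ)).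
  rewrite (hsum_app d _ _ _ _ _ _ HP1 HQ) in HP. simpl in HP.
  assert (forall h v P, 0 <= hsum (fun u t x => Rabs (h u t x)) v P)
    by (intros; apply hsum_nonneg; intros; apply Rabs_pos).
  assert (K1 := H0 (fun u t x => f t * (x - u) - (F x - F u)) a P1).
  assert (K2 := H0 (fun u t x => f t * (x - u) - (F x - F u)) x P2).
  simpl in K1, K2. lra.
Qed.

(** The tag is the point x itself, so only the number f x enters, even if f is unbounded near x. *)
Lemma primitive_from_continuous a f F : primitive_from a f F -> cont_from a F.
Proof.
  intros H. apply cont_fromP. intros x Hx e He.
  destruct (primitive_from_small_increment a f F x H Hx (e / 2)) as [d [Hd Hinc]]; [lra|].
  assert (Hf := Rabs_pos (f x)).
  set (d' := e / (2 * (Rabs (f x) + 1))).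
  assert (Hd' : 0 < d') by (apply Rdiv_lt_0_compat; lra).
  exists (Rmin d d'); split; [apply Rmin_pos; auto|].
  intros y Hy Hyx.
  assert (Hm1 := Rmin_l d d'). assert (Hm2 := Rmin_r d d').
  assert (Hb : Rabs (f x * (y - x)) < e / 2).
  { rewrite Rabs_mult. apply Rle_lt_trans with ((Rabs (f x) + 1) * Rabs (y - x)).
    - apply Rmult_le_compat_r; [apply Rabs_pos|lra].
    - apply Rlt_le_trans with ((Rabs (f x) + 1) * d').
      + apply Rmult_lt_compat_l; lra.
      + right; unfold d'; field; lra. }
  destruct (Rle_lt_dec x y) as [Hxy|Hxy].
  - specialize (Hinc x y). rewrite Rabs_pos_eq in Hyx by lra.
    apply Rabs_def2 in Hb.
    assert (Hi : Rabs (f x * (y - x) - (F y - F x)) <= e / 2) by (apply Hinc; lra).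
    apply Rabs_le_between in Hi. apply Rabs_def1; lra.
  - specialize (Hinc y x). rewrite Rabs_left in Hyx by lra.
    apply Rabs_def2 in Hb.
    assert (Hi : Rabs (f x * (x - y) - (F x - F y)) <= e / 2) by (apply Hinc; lra).
    apply Rabs_le_between in Hi. apply Rabs_def1; lra.
Qed.

Lemma primitive_from_derive a f F x :
  primitive_from a f F -> cont_from a f -> a < x -> is_derive F x (f x).
Proof.
  intros H Hc Hx. apply is_derive_Reals. intros e He.
  rewrite cont_fromP in Hc.
  destruct (Hc x) with (e := e / 2) as [d [Hd Hf]]; [lra|lra|].
  assert (Hdd : 0 < Rmin d (x - a)) by (apply Rmin_pos; lra).
  exists (mkposreal _ Hdd). intros h Hh Hhd. simpl in Hhd.
  assert (Hm1 := Rmin_l d (x - a)). assert (Hm2 := Rmin_r d (x - a)).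
  assert (Hb : forall u v, a <= u -> u <= v -> Rabs (u - x) < d -> Rabs (v - x) < d ->
             Rabs ((F v - F u) - f x * (v - u)) <= e / 2 * (v - u)).
  { intros u v Hu Huv Hud Hvd.
    assert (Hg := primitive_from_gint a f F u v H Hu Huv).
    apply is_gint_bound with (m := f x - e / 2) (M := f x + e / 2) in Hg.
    - apply Rabs_le; lra.
    - intros t Ht. assert (Ht' : Rabs (f t - f x) < e / 2).
      { apply Hf; [lra|]. apply Rabs_def2 in Hud. apply Rabs_def2 in Hvd. apply Rabs_def1; lra. }
      apply Rabs_def2 in Ht'. lra. }
  assert (Hd0 : Rabs (x - x) < d) by (rewrite Rminus_diag, Rabs_R0; lra).
  assert (Hdh : Rabs (x + h - x) < d) by (replace (x + h - x) with h by ring; lra).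
  replace ((F (x + h) - F x) / h - f x) with ((F (x + h) - F x - f x * h) / h) by (field; auto).
  unfold Rdiv. rewrite Rabs_mult, Rabs_inv.
  assert (Hpos := Rabs_pos_lt h Hh).
  apply (Rmult_lt_reg_r (Rabs h)); [auto|].
  rewrite Rmult_assoc, Rinv_l, Rmult_1_r by lra.
  apply Rle_lt_trans with (e / 2 * Rabs h); [|apply Rmult_lt_compat_r; lra].
  destruct (Rle_lt_dec 0 h).
  - assert (Hb' := Hb x (x + h)). rewrite (Rabs_pos_eq h) in * by lra.
    replace (x + h - x) with h in Hb' by ring. apply Hb'; auto; try lra.
    now replace (x + h - x) with h in Hdh by ring.
  - assert (Hb' := Hb (x + h) x). rewrite (Rabs_left h) in * by lra.
    rewrite Rabs_minus_sym.
    replace (f x * h - (F (x + h) - F x)) with (F x - F (x + h) - f x * (x - (x + h))) by ring.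
    replace (x - (x + h)) with (- h) in * by ring. apply Hb'; auto; lra.
Qed.

(** The gauge at t is the radius within which the difference quotient at t has error at most [k].
    Splitting each interval at its tag bounds the local error by k (x - u), and no integrability of
    f has to be known beforehand. *)
Lemma is_gint_derive f F a b :
  a <= b -> (forall x, a <= x <= b -> is_derive F x (f x)) -> is_gint f a b (F b - F a).
Proof.
  intros Hab H. apply gint_gauge_close with F; auto. intros e He.
  set (k := e / (b - a + 1)).
  assert (Hk : 0 < k) by (apply Rdiv_lt_0_compat; lra).
  assert (HD : forall t, exists d, 0 < d /\ (a <= t <= b -> forall y, Rabs (y - t) < d ->
             Rabs (F y - F t - f t * (y - t)) <= k * Rabs (y - t))).
  { intros t. destruct (classic (a <= t <= b)) as [Ht|Ht].
    - specialize (H t Ht). apply is_derive_Reals in H. destruct (H k Hk) as [d Hd].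
      exists d; split; [apply cond_pos|]. intros _ y Hy.
      destruct (Req_dec y t) as [->|Hne].
      { rewrite !Rminus_diag, Rmult_0_r, Rminus_diag, Rabs_R0. lra. }
      assert (Hyt : y - t <> 0) by lra.
      specialize (Hd (y - t) Hyt Hy). replace (t + (y - t)) with y in Hd by ring.
      replace (F y - F t - f t * (y - t)) with (((F y - F t) / (y - t) - f t) * (y - t)) by (field; auto).
      rewrite Rabs_mult. apply Rmult_le_compat_r; [apply Rabs_pos|lra].
    - exists 1; split; [lra|tauto]. }
  destruct (choice _ HD) as [d Hd]. exists d; split; [apply Hd|].
  intros P HP. apply Rle_trans with (hsum (fun u t x => k * (x - u)) a P).
  - eapply hsum_le; [|exact HP]. intros u t x Hu Hux Hx Ht H1 H2.
    destruct (Hd t) as [_ Hdt]. assert (Htab : a <= t <= b) by lra.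
    assert (D1 := Hdt Htab x). assert (D2 := Hdt Htab u).
    rewrite (Rabs_pos_eq (x - t)) in D1 by lra.
    rewrite (Rabs_left1 (u - t)) in D2 by lra.
    assert (E1 : x - t < d t) by lra. assert (E2 : - (u - t) < d t) by lra.
    specialize (D1 E1). specialize (D2 E2).
    apply Rabs_le_between in D1. apply Rabs_le_between in D2. apply Rabs_le. lra.
  - rewrite hsum_scal, (hsum_telescope d (fun x => x) a b) by auto.
    apply Rle_trans with (k * (b - a + 1)); [apply Rmult_le_compat_l; lra|].
    right; unfold k; field; lra.
Qed.

Lemma cont_from_ex_primitive a f : cont_from a f -> exists F, primitive_from a f F.
Proof.
  intros H. set (g := fun y => f (Rmax a y)).
  exists (RInt g a). intros x Hx.
  apply is_gint_ext with g.
  { intros t Ht. unfold g. now rewrite Rmax_right by lra. }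
  apply is_gint_derive; auto. intros t _.
  apply (is_derive_RInt g (RInt g a) a t); [|apply H].
  apply filter_forall. intros y. apply (RInt_correct g).
  apply (ex_RInt_continuous g). intros; apply H.
Qed.

(** Only f may be unbounded: continuity of g makes G Lipschitz, while F is merely continuous. That
    is just enough to control the second-order remainder of the product. *)
Lemma primitive_from_mult a f F g G :
  primitive_from a f F -> primitive_from a g G -> cont_from a g ->
  primitive_from a (fun t => f t * G t + F t * g t) (fun t => F t * G t).
Proof.
  intros HF HG Hg b Hab.
  assert (CF := primitive_from_continuous _ _ _ HF).
  assert (CG := primitive_from_continuous _ _ _ HG).
  destruct (cont_from_bounded a F b Hab CF) as [MF [MF0 HMF]].
  destruct (cont_from_bounded a G b Hab CG) as [MG [MG0 HMG]].
  destruct (cont_from_bounded a g b Hab Hg) as [Mg [Mg0 HMg]].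
  assert (HLip : forall u v, a <= u -> u <= v -> v <= b -> Rabs (G v - G u) <= Mg * (v - u)).
  { intros u v Hu Huv Hv.
    assert (K := primitive_from_gint a g G u v HG Hu Huv).
    apply is_gint_bound with (m := - Mg) (M := Mg) in K.
    - apply Rabs_le; lra.
    - intros t Ht. apply Rabs_le_between. apply HMg; lra. }
  apply gint_gauge_close with (fun t => F t * G t); auto. intros e He.
  (* [N - 1] collects the coefficients of [k] in the final estimate, and the added 1 makes [N]
     positive. *)
  set (N := MG + MF + Mg * (b - a) + 1).
  assert (HN : 0 <= Mg * (b - a)) by (apply Rmult_le_pos; lra).
  assert (HN1 : 0 < N) by (unfold N; lra).
  set (k := e / N).
  assert (Hk : 0 < k) by (apply Rdiv_lt_0_compat; lra).
  destruct (saks_henstock f F a b Hab HF k Hk) as [d1 [Hd1 H1]].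
  destruct (saks_henstock g G a b Hab HG k Hk) as [d2 [Hd2 H2]].
  assert (HD : forall t, exists d, 0 < d /\ (a <= t -> forall y, a <= y -> Rabs (y - t) < d ->
             Rabs (F y - F t) <= k)).
  { intros t. destruct (Rle_lt_dec a t) as [Ht|Ht].
    - rewrite cont_fromP in CF. destruct (CF t Ht k Hk) as [d [Hd Hy]].
      exists d; split; auto. intros _ y Hya Hyt. left; auto.
    - exists 1; split; [lra|intros; lra]. }
  destruct (choice _ HD) as [d3 Hd3].
  exists (gmin (gmin d1 d2) d3); split.
  { apply gmin_pos; [apply gmin_pos; auto|apply Hd3]. }
  intros P HP.
  specialize (H1 P (fine_gmin_l _ _ _ _ _ (fine_gmin_l _ _ _ _ _ HP))).
  specialize (H2 P (fine_gmin_r _ _ _ _ _ (fine_gmin_l _ _ _ _ _ HP))).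
  apply fine_gmin_r in HP.
  apply Rle_trans with (hsum (fun u t x => MG * Rabs (f t * (x - u) - (F x - F u))
       + (MF * Rabs (g t * (x - u) - (G x - G u)) + k * Mg * (x - u))) a P).
  - eapply hsum_le; [|exact HP]. intros u t x Hu Hux Hx Ht Ht1 Ht2.
    (* The local error of the product is the two weighted local errors plus a remainder. In each
       product of the remainder the increment of F is at most [k] by the choice of [d3], and that of
       G is at most [Mg] times the length. *)
    replace ((f t * G t + F t * g t) * (x - u) - (F x * G x - F u * G u)) with
      (G t * (f t * (x - u) - (F x - F u)) + (F t * (g t * (x - u) - (G x - G u))
       + ((F u - F t) * (G u - G t) - (F x - F t) * (G x - G t)))) by ring.
    eapply Rle_trans; [apply Rabs_triang|]. apply Rplus_le_compat.
    { rewrite Rabs_mult. apply Rmult_le_compat_r; [apply Rabs_pos|apply HMG; lra]. }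
    eapply Rle_trans; [apply Rabs_triang|]. apply Rplus_le_compat.
    { rewrite Rabs_mult. apply Rmult_le_compat_r; [apply Rabs_pos|apply HMF; lra]. }
    replace (k * Mg * (x - u)) with (k * (Mg * (t - u)) + k * (Mg * (x - t))) by ring.
    unfold Rminus at 1. eapply Rle_trans; [apply Rabs_triang|].
    rewrite Rabs_Ropp, !Rabs_mult.
    destruct (Hd3 t) as [_ Hd3t].
    apply Rplus_le_compat; apply Rmult_le_compat; try apply Rabs_pos.
    + apply Hd3t; try lra. rewrite Rabs_left1; lra.
    + rewrite Rabs_minus_sym. apply HLip; lra.
    + apply Hd3t; try lra. rewrite Rabs_pos_eq; lra.
    + apply HLip; lra.
  - rewrite !hsum_plus, !hsum_scal.
    rewrite (hsum_telescope _ (fun x => x) _ _ _ HP).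
    apply Rle_trans with (MG * k + (MF * k + k * Mg * (b - a))).
    + apply Rplus_le_compat; [apply Rmult_le_compat_l; auto|].
      apply Rplus_le_compat_r. apply Rmult_le_compat_l; auto.
    + replace (MG * k + (MF * k + k * Mg * (b - a))) with (k * (N - 1)) by (unfold N; ring).
      apply Rle_trans with (k * N); [apply Rmult_le_compat_l; lra|].
      right; unfold k; field; lra.
Qed.

(** * Positivity of the integral and decay of the tail [epsf] *)

Lemma is_gint_nonneg f a b I : (forall t, 0 <= f t) -> is_gint f a b I -> 0 <= I.
Proof.
  intros Hf H.
  apply Rnot_lt_le; intros Hlt. destruct H as [Hab H].
  destruct (H (- I / 2)) as [d [Hd HP]]; [lra|].
  destruct (cousin d a b) as [P Hfine]; auto.
  specialize (HP P Hfine). rewrite rsum_hsum in HP.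
  assert (hsum (fun _ _ _ => 0) a P <= hsum (fun u t x => f t * (x - u)) a P).
  { eapply hsum_le; [|exact Hfine]. intros. apply Rmult_le_pos; [auto|lra]. }
  assert (0 <= hsum (fun _ _ _ => 0) a P) by (apply hsum_nonneg; intros; lra).
  apply Rabs_def2 in HP. lra.
Qed.

Lemma is_gint_refl_0 f a I : is_gint f a a I -> I = 0.
Proof.
  intros H. assert (K := is_gint_diff f a a a I I (Rle_refl a) H H).
  rewrite (is_gint_unique _ _ _ _ _ H K). lra.
Qed.

(** The partial integrals [G] increase to their supremum [L], so the tail from x is L - G x. Since
    [epsf] is a chosen value and [improper_int] constrains only those b at which an integral exists,
    identifying it with this tail uses integrability on every bounded interval. *)
Lemma epsf_tends_to_0 pd qd x0 :
  0 <= x0 -> L1_from pd 0 -> L1_from qd x0 -> tends_to_inf (epsf pd qd) 0.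
Proof.
  intros Hx0 (_ & Hp & Mp & HMp) (_ & Hq & Mq & HMq).
  set (f := fun t => Rabs (pd t) + Rabs (qd t)).
  assert (HG : forall b, exists I, x0 <= b -> is_gint f x0 b I /\ I <= Mp + Mq).
  { intros b. destruct (Rle_lt_dec x0 b) as [Hb|Hb]; [|exists 0; intros; lra].
    destruct (Hp x0) as [I0 HI0]; [lra|].
    destruct (Hp b) as [I1 HI1]; [lra|].
    destruct (Hq b) as [I2 HI2]; [lra|].
    exists ((I1 - I0) + I2). intros _; split.
    - apply is_gint_plus; auto. apply is_gint_diff with 0; auto.
    - assert (0 <= I0) by (eapply is_gint_nonneg; [|exact HI0]; intros; apply Rabs_pos).
      assert (I1 <= Mp) by (eapply HMp; [|exact HI1]; lra).
      assert (I2 <= Mq) by (eapply HMq; [|exact HI2]; lra). lra. }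
  destruct (choice _ HG) as [G HG']. clear HG.
  assert (Hdiff : forall x b, x0 <= x -> x <= b -> is_gint f x b (G b - G x)).
  { intros x b Hx Hb. apply is_gint_diff with x0; [auto|apply HG'; lra|apply HG'; lra]. }
  assert (Hmono : forall x b, x0 <= x -> x <= b -> G x <= G b).
  { intros x b Hx Hb. cut (0 <= G b - G x); [lra|].
    eapply is_gint_nonneg; [|apply (Hdiff x b); auto].
    intros t. unfold f. assert (H1 := Rabs_pos (pd t)). assert (H2 := Rabs_pos (qd t)). lra. }
  destruct (completeness (fun r => exists b, x0 <= b /\ r = G b)) as [L [Hub Hlub]].
  { exists (Mp + Mq). intros r [b [Hb ->]]. apply HG'; auto. }
  { exists (G x0), x0. split; [lra|reflexivity]. }
  assert (Hlim : forall e, 0 < e -> exists B, x0 <= B /\ forall b, B <= b -> L - e < G b <= L).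
  { intros e He.
    assert (HB : exists B, x0 <= B /\ L - e < G B).
    { apply NNPP; intros HN. assert (L <= L - e); [|lra].
      apply Hlub. intros r [b [Hb ->]]. apply Rnot_lt_le. intros Hlt. apply HN; eauto. }
    destruct HB as [B [HB HLB]]. exists B; split; auto. intros b Hb. split.
    - specialize (Hmono B b HB Hb). lra.
    - apply Hub. exists b. split; [lra|reflexivity]. }
  assert (Himp : forall x, x0 <= x -> improper_int f x (L - G x)).
  { intros x Hx e He. destruct (Hlim e He) as [B [HB HLB]].
    exists (Rmax B x). intros b I Hb HI.
    assert (Hm1 := Rmax_l B x). assert (Hm2 := Rmax_r B x).
    assert (I = G b - G x).
    { apply (is_gint_unique f x b); auto. apply Hdiff; lra. }
    specialize (HLB b). apply Rabs_def1; lra. }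
  intros e He. destruct (Hlim e He) as [B [HB HLB]].
  exists B. intros x Hx.
  assert (Heps : epsf pd qd x = L - G x).
  { assert (HE : improper_int f x (epsf pd qd x)).
    { unfold epsf. apply epsilon_spec. exists (L - G x). apply Himp; lra. }
    cut (epsf pd qd x - (L - G x) = 0); [lra|].
    apply Rabs_le_all_eq_0. intros e' He'.
    destruct (HE (e'/2)) as [B1 H1]; [lra|].
    destruct (Himp x) with (e := e'/2) as [B2 H2]; [lra|lra|].
    set (b := Rmax x (Rmax B1 B2)).
    assert (x <= b) by apply Rmax_l.
    assert (B1 <= b) by (eapply Rle_trans; [apply Rmax_l|apply Rmax_r]).
    assert (B2 <= b) by (eapply Rle_trans; [apply Rmax_r|apply Rmax_r]).
    assert (K : is_gint f x b (G b - G x)) by (apply Hdiff; lra).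
    specialize (H1 b _ H0 K). specialize (H2 b _ H3 K).
    apply Rabs_def2 in H1. apply Rabs_def2 in H2. apply Rabs_le. lra. }
  specialize (HLB x Hx). rewrite Heps. apply Rabs_def1; lra.
Qed.

(** * The field of complex numbers and its norm *)

Lemma Cplx_ext (a b : Cplx) : fst a = fst b -> snd a = snd b -> a = b.
Proof. destruct a, b; simpl; congruence. Qed.

Lemma Cplx_neq0 (a : Cplx) : a <> Czero -> 0 < fst a ^ 2 + snd a ^ 2.
Proof.
  intros H. apply Rnot_le_lt. intros Hle. apply H.
  apply Cplx_ext; simpl in *; nra.
Qed.

Lemma Cplx_ring : ring_theory Czero Cone Cadd Cmul Csub Copp (@eq Cplx).
Proof.
  constructor; intros; try reflexivity; apply Cplx_ext; simpl; ring.
Qed.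

Lemma Cplx_field : field_theory Czero Cone Cadd Cmul Csub Copp
  (fun a b => Cmul a (Cinv b)) Cinv (@eq Cplx).
Proof.
  constructor.
  - exact Cplx_ring.
  - intros H. injection H. lra.
  - reflexivity.
  - intros a Ha. apply Cplx_neq0 in Ha. apply Cplx_ext; simpl in *; field; lra.
Qed.

Add Field Cplx_field_instance : Cplx_field.

Lemma Cscal_RtoC r a : Cscal r a = Cmul (RtoC r) a.
Proof. apply Cplx_ext; simpl; ring. Qed.

Lemma RtoC_inv r : r <> 0 -> RtoC (/ r) = Cinv (RtoC r).
Proof. intros H. apply Cplx_ext; simpl; field; auto. Qed.

Lemma RtoC_neq0 r : r <> 0 -> RtoC r <> Czero.
Proof. intros H E. injection E. auto. Qed.

Lemma Cmul_neq0 a b : a <> Czero -> b <> Czero -> Cmul a b <> Czero.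
Proof.
  intros Ha Hb E. apply Hb.
  transitivity (Cmul (Cinv a) (Cmul a b)); [field; auto|rewrite E; ring].
Qed.

Lemma Cexp_neq0 a : Cexp a <> Czero.
Proof.
  intros E. injection E. intros H1 H2.
  assert (He := exp_pos (fst a)).
  assert (Hs := sin2_cos2 (snd a)). unfold Rsqr in Hs.
  apply Rmult_integral in H1. apply Rmult_integral in H2.
  destruct H1 as [H1|H1]; [lra|]. destruct H2 as [H2|H2]; [lra|].
  rewrite H1, H2 in Hs. lra.
Qed.

Lemma Cnorm_mul a b : Cnorm (Cmul a b) = Cnorm a * Cnorm b.
Proof. exact (Complex.Cmod_mult a b). Qed.

Lemma Cnorm_pos a : 0 <= Cnorm a.
Proof. apply sqrt_pos. Qed.

Lemma Cnorm_gt0 a : a <> Czero -> 0 < Cnorm a.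
Proof. intros H. apply sqrt_lt_R0. now apply Cplx_neq0. Qed.

Lemma Rabs_fst_le_Cnorm a : Rabs (fst a) <= Cnorm a.
Proof.
  unfold Cnorm. rewrite <- sqrt_Rsqr_abs. apply sqrt_le_1_alt. unfold Rsqr. nra.
Qed.

Lemma Rabs_snd_le_Cnorm a : Rabs (snd a) <= Cnorm a.
Proof.
  unfold Cnorm. rewrite <- sqrt_Rsqr_abs. apply sqrt_le_1_alt. unfold Rsqr. nra.
Qed.

Lemma Cnorm_le_sum a : Cnorm a <= Rabs (fst a) + Rabs (snd a).
Proof.
  unfold Cnorm. assert (H1 := Rabs_pos (fst a)). assert (H2 := Rabs_pos (snd a)).
  apply Rsqr_incr_0_var; [|lra]. rewrite Rsqr_sqrt by nra.
  rewrite <- (pow2_abs (fst a)), <- (pow2_abs (snd a)). unfold Rsqr. nra.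
Qed.

(** * Limits of complex functions along a filter *)

(** Componentwise limits reduce every rule to real ones. A general filter covers both limits at
    infinity and continuity at a point. *)
Definition clim (F : (R -> Prop) -> Prop) (f : R -> Cplx) (l : Cplx) : Prop :=
  filterlim (fun t => fst (f t)) F (locally (fst l)) /\
  filterlim (fun t => snd (f t)) F (locally (snd l)).

Lemma clim_eq F f l l' : clim F f l -> l = l' -> clim F f l'.
Proof. now intros H <-. Qed.

Section Filter.

Context {F : (R -> Prop) -> Prop} {FF : Filter F}.

Lemma rlim_plus f g (a b : R) : filterlim f F (locally a) -> filterlim g F (locally b) ->
  filterlim (fun t => f t + g t) F (locally (a + b)).
Proof.
  intros Hf Hg. apply (filterlim_comp_2 (G := locally a) (H := locally b)) with (3 := filterlim_plus a b); auto.
Qed.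

Lemma rlim_mult f g (a b : R) : filterlim f F (locally a) -> filterlim g F (locally b) ->
  filterlim (fun t => f t * g t) F (locally (a * b)).
Proof.
  intros Hf Hg. apply (filterlim_comp_2 (G := locally a) (H := locally b)) with (3 := filterlim_mult a b); auto.
Qed.

Lemma rlim_comp f (g : R -> R) (a : R) : filterlim f F (locally a) -> continuous g a ->
  filterlim (fun t => g (f t)) F (locally (g a)).
Proof. intros Hf Hg. eapply filterlim_comp; eauto. Qed.

Lemma rlim_const (c : R) : filterlim (fun _ => c) F (locally c).
Proof. apply filterlim_const. Qed.

Lemma rlim_opp f (a : R) : filterlim f F (locally a) ->
  filterlim (fun t => - f t) F (locally (- a)).
Proof. intros Hf. eapply filterlim_comp; [exact Hf|apply (filterlim_opp a)]. Qed.

Lemma rlim_inv f (a : R) : a <> 0 -> filterlim f F (locally a) ->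
  filterlim (fun t => / f t) F (locally (/ a)).
Proof.
  intros Ha Hf. apply rlim_comp; auto. apply continuity_pt_filterlim.
  apply (continuity_pt_inv (fun x => x)); auto. apply derivable_continuous_pt, derivable_pt_id.
Qed.

Lemma rlim_sqrt f (a : R) : filterlim f F (locally a) ->
  filterlim (fun t => sqrt (f t)) F (locally (sqrt a)).
Proof. intros Hf. apply rlim_comp; auto. apply continuous_sqrt. Qed.

Lemma rlim_sqr f (a : R) : filterlim f F (locally a) ->
  filterlim (fun t => f t ^ 2) F (locally (a ^ 2)).
Proof.
  intros Hf. simpl. apply rlim_mult; auto. apply rlim_mult; auto. apply rlim_const.
Qed.

Lemma clim_const c : clim F (fun _ => c) c.
Proof. split; apply rlim_const. Qed.

Lemma clim_add f g a b : clim F f a -> clim F g b -> clim F (fun t => Cadd (f t) (g t)) (Cadd a b).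
Proof. intros [H1 H2] [H3 H4]. split; simpl; apply rlim_plus; auto. Qed.

Lemma clim_opp f a : clim F f a -> clim F (fun t => Copp (f t)) (Copp a).
Proof. intros [H1 H2]. split; simpl; apply rlim_opp; auto. Qed.

Lemma clim_sub f g a b : clim F f a -> clim F g b -> clim F (fun t => Csub (f t) (g t)) (Csub a b).
Proof. intros H1 H2. apply clim_add; auto. now apply clim_opp. Qed.

Lemma clim_mul f g a b : clim F f a -> clim F g b -> clim F (fun t => Cmul (f t) (g t)) (Cmul a b).
Proof.
  intros [H1 H2] [H3 H4]. split; simpl.
  - apply rlim_plus; [|apply rlim_opp]; apply rlim_mult; auto.
  - apply rlim_plus; apply rlim_mult; auto.
Qed.

Lemma clim_RtoC f (a : R) : filterlim f F (locally a) -> clim F (fun t => RtoC (f t)) (RtoC a).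
Proof. intros H. split; simpl; auto. apply rlim_const. Qed.

Lemma clim_scal f g (a : R) b : filterlim f F (locally a) -> clim F g b ->
  clim F (fun t => Cscal (f t) (g t)) (Cscal a b).
Proof. intros H [H1 H2]. split; simpl; apply rlim_mult; auto. Qed.

Lemma clim_inv f a : a <> Czero -> clim F f a -> clim F (fun t => Cinv (f t)) (Cinv a).
Proof.
  intros Ha [H1 H2]. apply Cplx_neq0 in Ha.
  split; simpl; unfold Rdiv; apply rlim_mult; auto; try (apply rlim_opp; auto);
    (apply rlim_inv; [simpl in *; lra|]); apply rlim_plus; apply (rlim_sqr _ _); auto.
Qed.

Lemma clim_ext f g l : F (fun t => f t = g t) -> clim F f l -> clim F g l.
Proof.
  intros E [H1 H2]. split; eapply filterlim_ext_loc; eauto;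
    eapply filter_imp; try exact E; intros t Ht; simpl in *; congruence.
Qed.

End Filter.

Lemma tends_to_infP f l : tends_to_inf f l <-> filterlim f (Rbar_locally p_infty) (locally l).
Proof.
  split.
  - intros H P [e He]. destruct (H e (cond_pos e)) as [X HX].
    exists X. intros x Hx. apply He. apply HX; lra.
  - intros H e He. destruct (H (ball l (mkposreal e He))) as [X HX]; [apply locally_ball|].
    exists (X + 1). intros x Hx. apply HX; lra.
Qed.

Lemma Ctends_to_infP f l : Ctends_to_inf f l <-> clim (Rbar_locally p_infty) f l.
Proof.
  unfold clim. rewrite <- !tends_to_infP. split.
  - intros H; split; intros e He; destruct (H e He) as [X HX]; exists X; intros x Hx;
      eapply Rle_lt_trans; [|exact (HX x Hx)| |exact (HX x Hx)];
      [apply (Rabs_fst_le_Cnorm (Csub (f x) l))|apply (Rabs_snd_le_Cnorm (Csub (f x) l))].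
  - intros [H1 H2] e He.
    destruct (H1 (e/2)) as [X1 HX1]; [lra|]. destruct (H2 (e/2)) as [X2 HX2]; [lra|].
    exists (Rmax X1 X2). intros x Hx.
    assert (Hm1 := Rmax_l X1 X2). assert (Hm2 := Rmax_r X1 X2).
    eapply Rle_lt_trans; [apply Cnorm_le_sum|].
    assert (K1 : X1 <= x) by lra. assert (K2 : X2 <= x) by lra.
    specialize (HX1 x K1). specialize (HX2 x K2).
    simpl. unfold Rminus in *. lra.
Qed.

Lemma at_infty_ge X : Rbar_locally p_infty (fun x => X <= x).
Proof. exists X. intros; lra. Qed.

(** * Derivatives of complex functions of a real variable *)

Definition cderive (f : R -> Cplx) (x : R) (l : Cplx) : Prop :=
  is_derive (fun t => fst (f t)) x (fst l) /\ is_derive (fun t => snd (f t)) x (snd l).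

Lemma is_derive_eq (f : R -> R) (x l l' : R) : is_derive f x l -> l = l' -> is_derive f x l'.
Proof. now intros H <-. Qed.

Lemma cderive_eq f x l l' : cderive f x l -> l = l' -> cderive f x l'.
Proof. now intros H <-. Qed.

Lemma cderive_unique f x l l' : cderive f x l -> cderive f x l' -> l = l'.
Proof.
  intros [H1 H2] [H3 H4]. apply Cplx_ext.
  - rewrite <- (is_derive_unique _ _ _ H1). now apply is_derive_unique.
  - rewrite <- (is_derive_unique _ _ _ H2). now apply is_derive_unique.
Qed.

Lemma cderive_ext f g x l : locally x (fun t => f t = g t) -> cderive f x l -> cderive g x l.
Proof.
  intros E [H1 H2]. split; eapply is_derive_ext_loc; eauto;
    eapply filter_imp; try exact E; intros t Ht; simpl in *; congruence.
Qed.

Lemma cderive_const c x : cderive (fun _ => c) x Czero.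
Proof. split; apply (is_derive_const (V := R_NormedModule)). Qed.

Lemma cderive_opp f x l : cderive f x l -> cderive (fun t => Copp (f t)) x (Copp l).
Proof. intros [H1 H2]; split; simpl; apply (is_derive_opp (V := R_NormedModule)); auto. Qed.

Lemma cderive_sub f g x l m :
  cderive f x l -> cderive g x m -> cderive (fun t => Csub (f t) (g t)) x (Csub l m).
Proof.
  intros [H1 H2] [H3 H4]; split; simpl; apply (is_derive_minus (V := R_NormedModule)); auto.
Qed.

Lemma is_derive_Rmult (f g : R -> R) (x l m : R) : is_derive f x l -> is_derive g x m ->
  is_derive (fun t => f t * g t) x (l * g x + f x * m).
Proof. intros Hf Hg. exact (is_derive_mult f g x l m Hf Hg Rmult_comm). Qed.

Lemma cderive_mul f g x l m :
  cderive f x l -> cderive g x m ->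
  cderive (fun t => Cmul (f t) (g t)) x (Cadd (Cmul l (g x)) (Cmul (f x) m)).
Proof.
  intros [H1 H2] [H3 H4]; split; simpl.
  - eapply is_derive_eq.
    + apply (is_derive_minus (V := R_NormedModule)); apply is_derive_Rmult; eauto.
    + unfold minus, plus, opp; simpl. ring.
  - eapply is_derive_eq.
    + apply (is_derive_plus (V := R_NormedModule)); apply is_derive_Rmult; eauto.
    + unfold plus; simpl. ring.
Qed.

Lemma cderive_inv f x l : f x <> Czero -> cderive f x l ->
  cderive (fun t => Cinv (f t)) x (Copp (Cmul l (Cinv (Cmul (f x) (f x))))).
Proof.
  intros Hx [H1 H2]. apply Cplx_neq0 in Hx.
  set (u := fun t => fst (f t)) in *. set (v := fun t => snd (f t)) in *.
  assert (E1 : Derive u x = fst l) by now apply is_derive_unique.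
  assert (E2 : Derive v x = snd l) by now apply is_derive_unique.
  assert (D1 : ex_derive u x) by (eexists; eauto).
  assert (D2 : ex_derive v x) by (eexists; eauto).
  change (fst (f x)) with (u x) in Hx. change (snd (f x)) with (v x) in Hx.
  assert (Hn : u x ^ 2 + v x ^ 2 <> 0) by lra.
  assert (Hn2 : (u x * u x - v x * v x) ^ 2 + (u x * v x + v x * u x) ^ 2 <> 0).
  { replace ((u x * u x - v x * v x) ^ 2 + (u x * v x + v x * u x) ^ 2)
      with ((u x ^ 2 + v x ^ 2) ^ 2) by ring. now apply pow_nonzero. }
  split.
  - change (is_derive (fun t => u t / (u t ^ 2 + v t ^ 2)) x
      (- (fst l * ((u x * u x - v x * v x) / ((u x * u x - v x * v x) ^ 2 + (u x * v x + v x * u x) ^ 2))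
         - snd l * (- (u x * v x + v x * u x) / ((u x * u x - v x * v x) ^ 2 + (u x * v x + v x * u x) ^ 2))))).
    auto_derive; [repeat split; auto; simpl in *; lra|].
    change (Derive (fun x => u x) x) with (Derive u x).
    change (Derive (fun x => v x) x) with (Derive v x).
    rewrite E1, E2. field.
    repeat split; intros Z; first [apply Hn; rewrite <- Z; ring | apply Hn2; rewrite <- Z; ring].
  - change (is_derive (fun t => - v t / (u t ^ 2 + v t ^ 2)) x
      (- (fst l * (- (u x * v x + v x * u x) / ((u x * u x - v x * v x) ^ 2 + (u x * v x + v x * u x) ^ 2))
         + snd l * ((u x * u x - v x * v x) / ((u x * u x - v x * v x) ^ 2 + (u x * v x + v x * u x) ^ 2))))).
    auto_derive; [repeat split; auto; simpl in *; lra|].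
    change (Derive (fun x => u x) x) with (Derive u x).
    change (Derive (fun x => v x) x) with (Derive v x).
    rewrite E1, E2. field.
    repeat split; intros Z; first [apply Hn; rewrite <- Z; ring | apply Hn2; rewrite <- Z; ring].
Qed.

Lemma cderive_exp f x l : cderive f x l -> cderive (fun t => Cexp (f t)) x (Cmul l (Cexp (f x))).
Proof.
  intros [H1 H2].
  set (u := fun t => fst (f t)) in *. set (v := fun t => snd (f t)) in *.
  assert (E1 : Derive u x = fst l) by now apply is_derive_unique.
  assert (E2 : Derive v x = snd l) by now apply is_derive_unique.
  assert (D1 : ex_derive u x) by (eexists; eauto).
  assert (D2 : ex_derive v x) by (eexists; eauto).
  split.
  - change (is_derive (fun t => exp (u t) * cos (v t)) x
       (fst l * (exp (u x) * cos (v x)) - snd l * (exp (u x) * sin (v x)))).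
    auto_derive; [auto|].
    change (Derive (fun x => u x) x) with (Derive u x).
    change (Derive (fun x => v x) x) with (Derive v x).
    rewrite E1, E2. ring.
  - change (is_derive (fun t => exp (u t) * sin (v t)) x
       (fst l * (exp (u x) * sin (v x)) + snd l * (exp (u x) * cos (v x)))).
    auto_derive; [auto|].
    change (Derive (fun x => u x) x) with (Derive u x).
    change (Derive (fun x => v x) x) with (Derive v x).
    rewrite E1, E2. ring.
Qed.

(** * Differential inequalities and damped linear equations *)

Lemma derive_nonpos_le f df a b :
  a <= b -> (forall x, a <= x <= b -> is_derive f x (df x)) ->
  (forall x, a <= x <= b -> df x <= 0) -> f b <= f a.
Proof.
  intros Hab Hf Hdf.
  destruct (MVT_gen f a b df) as [c [Hc E]].
  - rewrite Rmin_left, Rmax_right by lra. intros; apply Hf; lra.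
  - rewrite Rmin_left, Rmax_right by lra. intros x Hx.
    apply continuity_pt_filterlim. apply (ex_derive_continuous f). eexists; apply Hf; lra.
  - rewrite Rmin_left, Rmax_right in Hc by lra. specialize (Hdf c Hc). nra.
Qed.

Lemma cderive_0_const f a b :
  a <= b -> (forall x, a <= x <= b -> cderive f x Czero) -> f b = f a.
Proof.
  intros Hab Hf.
  assert (K : forall g : R -> R, (forall x, a <= x <= b -> is_derive g x 0) -> g b = g a).
  { intros g Hg. apply Rle_antisym.
    - apply (derive_nonpos_le g (fun _ => 0)); auto; intros; lra.
    - assert (H : - g b <= - g a); [|lra].
      apply (derive_nonpos_le (fun t => - g t) (fun _ => - 0)); auto; [|intros; lra].
      intros x Hx. apply (is_derive_opp (V := R_NormedModule) g); auto. }
  apply Cplx_ext.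
  - apply (K (fun t => fst (f t))). intros; now apply Hf.
  - apply (K (fun t => snd (f t))). intros; now apply Hf.
Qed.

Lemma derive_ge_diverges (f df : R -> R) k X :
  0 < k -> (forall x, X <= x -> is_derive f x (df x) /\ k <= df x) ->
  forall M, exists Y, forall x, Y <= x -> M <= f x.
Proof.
  intros Hk H M. exists (Rmax X (X + (M - f X) / k)). intros x Hx.
  assert (Hm1 := Rmax_l X (X + (M - f X) / k)). assert (Hm2 := Rmax_r X (X + (M - f X) / k)).
  assert (K : k * x - f x <= k * X - f X).
  { apply (derive_nonpos_le (fun t => k * t - f t) (fun t => k - df t)); [lra| |].
    - intros t Ht. apply (is_derive_minus (V := R_NormedModule) (fun t => k * t) f).
      + eapply is_derive_eq; [apply is_derive_Rmult;
          [apply (is_derive_const (V := R_NormedModule))|apply (is_derive_id (K := R_AbsRing))]|].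
        unfold zero, one; simpl; ring.
      + apply H; lra.
    - intros t Ht. destruct (H t); lra. }
  assert (E : k * ((M - f X) / k) = M - f X) by (field; lra).
  assert (k * ((M - f X) / k) <= k * (x - X)) by (apply Rmult_le_compat_l; lra).
  lra.
Qed.

(** The function (m - e) exp(c (x - X)) is nonincreasing, so the excess of m over e decays
    exponentially. The waiting time A / (c e) comes from 1 + y <= exp y, which makes the exponential
    at least A / e + 1 and avoids logarithms. *)
Lemma gronwall_decay (m dm : R -> R) c :
  0 < c ->
  (forall eta, 0 < eta -> exists X, forall x, X <= x ->
     is_derive m x (dm x) /\ dm x <= - c * m x + c * eta) ->
  forall eta, 0 < eta -> exists X, forall x, X <= x -> m x < eta.
Proof.
  intros Hc H eta Heta. set (e := eta / 2).
  assert (He : 0 < e) by (unfold e; lra).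
  destruct (H e He) as [X HX].
  set (A := Rabs (m X - e)).
  assert (HA : 0 <= A) by apply Rabs_pos.
  assert (HAe : 0 <= A / (c * e)).
  { apply Rmult_le_pos; auto. left. apply Rinv_0_lt_compat. now apply Rmult_lt_0_compat. }
  exists (X + A / (c * e)). intros x Hx.
  assert (K : (m x - e) * exp (c * (x - X)) <= (m X - e) * exp (c * (X - X))).
  { apply (derive_nonpos_le (fun t => (m t - e) * exp (c * (t - X)))
       (fun t => dm t * exp (c * (t - X)) + (m t - e) * (c * exp (c * (t - X))))); [lra| |].
    - intros t Ht. apply (is_derive_Rmult (fun t => m t - e) (fun t => exp (c * (t - X)))).
      + destruct (HX t) as [D _]; [lra|].
        eapply is_derive_eq; [apply (is_derive_minus (V := R_NormedModule) m (fun _ => e));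
          [exact D|apply (is_derive_const (V := R_NormedModule))]|].
        unfold minus, plus, opp, zero; simpl. ring.
      + auto_derive; [exact I|]. unfold Rminus. now rewrite Rmult_1_r.
    - intros t Ht. destruct (HX t) as [_ D]; [lra|].
      assert (P := exp_pos (c * (t - X))). nra. }
  rewrite Rminus_diag, Rmult_0_r, exp_0, Rmult_1_r in K.
  assert (HE : A / e + 1 <= exp (c * (x - X))).
  { apply Rle_trans with (1 + c * (x - X)); [|apply exp_ineq1_le].
    assert (E : c * (A / (c * e)) = A / e) by (field; lra).
    assert (c * (A / (c * e)) <= c * (x - X)) by (apply Rmult_le_compat_l; lra). lra. }
  assert (m X - e <= A) by apply Rle_abs.
  assert (E : A / e * e = A) by (field; lra).
  assert (m x - e < e); [|unfold e in *; lra].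
  apply Rnot_le_lt. intros Hle.
  assert (e * (A / e + 1) <= (m x - e) * exp (c * (x - X))); [|lra].
  apply Rmult_le_compat; try lra.
  assert (0 <= A / e); [|lra].
  apply Rmult_le_pos; auto. left. now apply Rinv_0_lt_compat.
Qed.

(* [|k|^2] is a Lyapunov function: AM-GM absorbs the cross term with [r]. *)
Lemma linear_ode_decay (k om r : R -> Cplx) (om_inf : Cplx) X :
  (forall x, X <= x ->
     cderive k x (Csub (r x) (Cmul (Cadd (om x) (om x)) (k x)))) ->
  clim (Rbar_locally p_infty) om om_inf -> 0 < fst om_inf ->
  clim (Rbar_locally p_infty) r Czero ->
  clim (Rbar_locally p_infty) k Czero.
Proof.
  intros Hk [Hom _] Hpos [Hr1 Hr2].
  (* Half of the limiting damping, so that Re [om] is at least [c] from some point on. *)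
  set (c := fst om_inf / 2). assert (Hc : 0 < c) by (unfold c; lra).
  assert (Hr : tends_to_inf (fun t => fst (r t) ^ 2 + snd (r t) ^ 2) (0 ^ 2 + 0 ^ 2)).
  { apply tends_to_infP. apply rlim_plus; apply rlim_sqr; auto. }
  apply tends_to_infP in Hom.
  assert (Hm : forall eta, 0 < eta -> exists Y, forall x, Y <= x ->
             fst (k x) ^ 2 + snd (k x) ^ 2 < eta).
  { set (dm := fun x => let d := Csub (r x) (Cmul (Cadd (om x) (om x)) (k x)) in
       2 * (fst (k x) * fst d + snd (k x) * snd d)).
    apply (gronwall_decay _ dm c Hc). intros eta Heta.
    destruct (Hom c Hc) as [X1 HX1].
    (* This tolerance makes |r|^2 / c smaller than c eta, the forcing allowed by
       [gronwall_decay]. *)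
    destruct (Hr (c * c * eta)) as [X2 HX2].
    { exact (Rmult_lt_0_compat _ _ (Rmult_lt_0_compat _ _ Hc Hc) Heta). }
    exists (Rmax X (Rmax X1 X2)). intros x Hx.
    assert (Hm1 := Rmax_l X (Rmax X1 X2)). assert (Hm2 := Rmax_r X (Rmax X1 X2)).
    assert (Hm3 := Rmax_l X1 X2). assert (Hm4 := Rmax_r X1 X2).
    split.
    - destruct (Hk x) as [D1 D2]; [lra|]. unfold dm.
      eapply is_derive_eq; [apply (is_derive_plus (V := R_NormedModule)
         (fun t => fst (k t) ^ 2) (fun t => snd (k t) ^ 2));
         apply (is_derive_pow _ 2); eassumption|].
      unfold plus; simpl. ring.
    - specialize (HX1 x). specialize (HX2 x).
      assert (B1 : Rabs (fst (om x) - fst om_inf) < c) by (apply HX1; lra).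
      assert (B2 : Rabs (fst (r x) ^ 2 + snd (r x) ^ 2 - (0 ^ 2 + 0 ^ 2)) < c * c * eta)
        by (apply HX2; lra).
      apply Rabs_def2 in B1. apply Rabs_def2 in B2. destruct B1 as [_ B1]. destruct B2 as [B2 _].
      assert (Ho : c <= fst (om x)) by (unfold c in *; lra).
      unfold dm. simpl.
      set (u := fst (k x)) in *. set (v := snd (k x)) in *.
      set (s := fst (r x)) in *. set (t := snd (r x)) in *. set (o := fst (om x)) in *.
      replace (2 * _) with (2 * (u * s + v * t) - 4 * o * (u ^ 2 + v ^ 2)) by ring.
      (* The inequality 2 k.r <= c |k|^2 + |r|^2 / c, multiplied by [c] to avoid the division. It is
         the expansion of |c k - r|^2 >= 0. *)
      assert (Q : c * (2 * (u * s + v * t)) <= c * (c * (u ^ 2 + v ^ 2)) + (s ^ 2 + t ^ 2)).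
      { assert (0 <= (c * u - s) ^ 2 + (c * v - t) ^ 2) by (apply Rplus_le_le_0_compat; apply pow2_ge_0).
        nra. }
      assert (Q2 : c * (u ^ 2 + v ^ 2) <= o * (u ^ 2 + v ^ 2)).
      { apply Rmult_le_compat_r; auto. apply Rplus_le_le_0_compat; apply pow2_ge_0. }
      assert (Q3 : 0 <= c * (u ^ 2 + v ^ 2)).
      { apply Rmult_le_pos; [lra|]. apply Rplus_le_le_0_compat; apply pow2_ge_0. }
      apply (Rmult_le_reg_l c); [auto|].
      replace (u * (u * 1) + v * (v * 1)) with (u ^ 2 + v ^ 2) by ring.
      nra. }
  split; apply tends_to_infP; intros e He; (destruct (Hm (e ^ 2)) as [Y HY]; [now apply pow_lt|]);
    exists Y; intros x Hx; specialize (HY x Hx); simpl (fst Czero); simpl (snd Czero);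
    rewrite Rminus_0_r, <- (Rabs_pos_eq e) by lra; apply Rsqr_lt_abs_0; unfold Rsqr; nra.
Qed.

(** * Behaviour of solutions at infinity *)

Lemma quotient_cderive (y y1 th th1 : R -> Cplx) (p : R -> R) x :
  p x <> 0 -> th x <> Czero ->
  cderive y x (Cscal (/ p x) (y1 x)) -> cderive th x (Cscal (/ p x) (th1 x)) ->
  cderive (fun t => Cmul (y t) (Cinv (th t))) x
    (Cmul (wronsk y y1 th th1 x) (Cinv (Cmul (RtoC (p x)) (Cmul (th x) (th x))))).
Proof.
  intros Hp Hth Dy Dth.
  eapply cderive_eq; [apply cderive_mul; [exact Dy|apply cderive_inv; [auto|exact Dth]]|].
  rewrite !Cscal_RtoC, !RtoC_inv by auto. unfold wronsk.
  field. repeat split; auto using RtoC_neq0.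
Qed.

(** [hinf] is the equilibrium of the limiting equation 0 = w / p0 - 2 om_inf h. The difference h -
    hinf therefore satisfies the same damped equation with a forcing that tends to zero and also
    absorbs the variation of [om] and [p]. *)
Lemma growing_solution_limit (a om y y1 th th1 : R -> Cplx) (p : R -> R) p0 om_inf w X :
  (forall x, X <= x -> a x <> Czero /\ th x <> Czero /\ p x <> 0) ->
  (forall x, X <= x -> cderive a x (Copp (Cmul (om x) (a x)))) ->
  (forall x, X <= x -> cderive y x (Cscal (/ p x) (y1 x))) ->
  (forall x, X <= x -> cderive th x (Cscal (/ p x) (th1 x))) ->
  (forall x, X <= x -> wronsk y y1 th th1 x = w) ->
  clim (Rbar_locally p_infty) om om_inf -> 0 < fst om_inf ->
  tends_to_inf p p0 -> 0 < p0 ->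
  clim (Rbar_locally p_infty) (fun x => Cmul (th x) (Cinv (a x))) Cone ->
  clim (Rbar_locally p_infty) (fun x => Cmul (y x) (a x))
    (Cmul w (Cinv (Cscal 2 (Cmul (RtoC p0) om_inf)))).
Proof.
  intros Hnz Da Dy Dth Hw Hom Hpos Hp Hp0 HT.
  set (hinf := Cmul w (Cinv (Cscal 2 (Cmul (RtoC p0) om_inf)))).
  set (h := fun x => Cmul (Cmul (a x) (a x)) (Cmul (y x) (Cinv (th x)))).
  assert (Hp0' : RtoC p0 <> Czero) by (apply RtoC_neq0; lra).
  assert (Hom0 : om_inf <> Czero) by (intros E; rewrite E in Hpos; simpl in Hpos; lra).
  assert (H2 : RtoC 2 <> Czero) by (apply RtoC_neq0; lra).
  assert (H1 : Cone <> Czero) by (apply RtoC_neq0; lra).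
  assert (Hh : clim (Rbar_locally p_infty) h hinf).
  { assert (Hk : clim (Rbar_locally p_infty) (fun x => Csub (h x) hinf) Czero).
    { apply linear_ode_decay with (om := om) (om_inf := om_inf) (X := X)
        (r := fun x => Csub (Cmul w (Cinv (Cmul (RtoC (p x))
             (Cmul (Cmul (th x) (Cinv (a x))) (Cmul (th x) (Cinv (a x)))))))
             (Cmul (Cadd (om x) (om x)) hinf)); auto.
      - intros x Hx. destruct (Hnz x Hx) as (Ha & Ht & Hpx).
        assert (Hpx' : RtoC (p x) <> Czero) by now apply RtoC_neq0.
        eapply cderive_eq.
        + apply cderive_sub; [|apply cderive_const].
          apply cderive_mul.
          * apply cderive_mul; apply Da; auto.
          * apply (quotient_cderive y y1 th th1 p); auto.
        + rewrite (Hw x Hx). unfold h. field. auto.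
      - eapply clim_eq.
        1: { apply clim_sub.
             - apply clim_mul; [apply clim_const|]. apply clim_inv.
               2: { apply clim_mul; [apply clim_RtoC, tends_to_infP, Hp|].
                    apply clim_mul; exact HT. }
               repeat apply Cmul_neq0; auto.
             - apply clim_mul; [|apply clim_const]. apply clim_add; exact Hom. }
        unfold hinf. rewrite Cscal_RtoC.
        replace (RtoC 2) with (Cadd Cone Cone) in * by (apply Cplx_ext; simpl; ring).
        field. auto. }
    apply clim_ext with (fun x => Cadd (Csub (h x) hinf) hinf).
    { apply filter_forall. intros x. ring. }
    apply clim_eq with (Cadd Czero hinf); [|ring].
    apply clim_add; [exact Hk|apply clim_const]. }
  (* Back from h to the solution: y a = h (th / a), and the last factor tends to 1. *)
  apply clim_ext with (fun x => Cmul (h x) (Cmul (th x) (Cinv (a x)))).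
  { eapply filter_imp; [|apply (at_infty_ge X)]. intros x Hx.
    destruct (Hnz x Hx) as (Ha & Ht & _). unfold h. field. auto. }
  apply clim_eq with (Cmul hinf Cone); [|ring].
  now apply clim_mul.
Qed.

(** If th tends to c, then th1' tends to d = -z c, which is nonzero. The projection of th1 onto d
    thus grows at least linearly, so that of th' = th1 / p is eventually bounded below, and th
    cannot converge. Projecting onto d reduces the argument to real functions. *)
Lemma no_solution_with_nonzero_limit (th th1 : R -> Cplx) (p q : R -> R) p0 z c X :
  (forall x, X <= x -> cderive th x (Cscal (/ p x) (th1 x))) ->
  (forall x, X <= x -> cderive th1 x (Cmul (Csub (RtoC (q x)) z) (th x))) ->
  (forall x, X <= x -> 0 < p x) -> 0 < p0 -> tends_to_inf p p0 -> tends_to_inf q 0 ->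
  z <> Czero -> c <> Czero -> clim (Rbar_locally p_infty) th c -> False.
Proof.
  intros D D1 Hpp Hp0 Hp Hq Hz Hc Hth.
  set (d := Cmul (Csub (RtoC 0) z) c).
  assert (Hd : d <> Czero).
  { apply Cmul_neq0; auto. intros E. apply Hz.
    transitivity (Copp (Csub (RtoC 0) z)); [|rewrite E; ring].
    apply Cplx_ext; simpl; ring. }
  apply Cplx_neq0 in Hd.
  set (Dn := fst d ^ 2 + snd d ^ 2) in *.
  set (v := fun x => Cmul (Csub (RtoC (q x)) z) (th x)).
  assert (Hv : clim (Rbar_locally p_infty) v d).
  { apply clim_mul; auto. apply clim_sub; [|apply clim_const]. apply clim_RtoC, tends_to_infP, Hq. }
  assert (Hinner : forall f l x, cderive f x l ->
            is_derive (fun t => fst d * fst (f t) + snd d * snd (f t)) x (fst d * fst l + snd d * snd l)).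
  { intros f l x [E1 E2]. apply (is_derive_plus (V := R_NormedModule) (fun t => fst d * fst (f t)) (fun t => snd d * snd (f t)));
      apply is_derive_scal; auto. }
  assert (Hg : tends_to_inf (fun x => fst d * fst (v x) + snd d * snd (v x))
                 (fst d * fst d + snd d * snd d)).
  { destruct Hv. apply tends_to_infP. apply rlim_plus; apply rlim_mult; auto; apply rlim_const. }
  destruct (Hg (Dn / 2)) as [X1 HX1]; [lra|].
  destruct (derive_ge_diverges (fun x => fst d * fst (th1 x) + snd d * snd (th1 x))
     (fun x => fst d * fst (v x) + snd d * snd (v x)) (Dn / 2) (Rmax X X1))
     (* Once p < 2 p0, a projection of [th1] of at least 2 p0 gives th' a projection of at least
        1. *)
     with (M := 2 * p0) as [X2 HX2].
  { lra. }
  { intros x Hx. assert (Hm1 := Rmax_l X X1). assert (Hm2 := Rmax_r X X1). split.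
    - apply Hinner. apply D1; lra.
    - assert (B : X1 <= x) by lra. specialize (HX1 x B). apply Rabs_def2 in HX1. unfold Dn in *. lra. }
  destruct (Hp p0 Hp0) as [X3 HX3].
  set (B0 := fst d * fst c + snd d * snd c).
  destruct (derive_ge_diverges (fun x => fst d * fst (th x) + snd d * snd (th x))
     (fun x => fst d * fst (Cscal (/ p x) (th1 x)) + snd d * snd (Cscal (/ p x) (th1 x))) 1
     (Rmax X (Rmax X2 X3))) with (M := B0 + 1) as [X4 HX4].
  { lra. }
  { intros x Hx. assert (Hm1 := Rmax_l X (Rmax X2 X3)). assert (Hm2 := Rmax_r X (Rmax X2 X3)).
    assert (Hm3 := Rmax_l X2 X3). assert (Hm4 := Rmax_r X2 X3). split.
    - apply Hinner. apply D; lra.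
    - assert (B : X2 <= x) by lra. specialize (HX2 x B).
      assert (B' : X3 <= x) by lra. specialize (HX3 x B'). apply Rabs_def2 in HX3.
      assert (Hpx : 0 < p x) by (apply Hpp; lra).
      change (1 <= fst d * (/ p x * fst (th1 x)) + snd d * (/ p x * snd (th1 x))).
      replace (fst d * (/ p x * fst (th1 x)) + snd d * (/ p x * snd (th1 x)))
        with (/ p x * (fst d * fst (th1 x) + snd d * snd (th1 x))) by ring.
      apply (Rmult_le_reg_l (p x)); auto. rewrite <- Rmult_assoc, Rinv_r, Rmult_1_l by lra. lra. }
  assert (Hl : tends_to_inf (fun x => fst d * fst (th x) + snd d * snd (th x)) B0).
  { destruct Hth. apply tends_to_infP. apply rlim_plus; apply rlim_mult; auto; apply rlim_const. }
  destruct (Hl 1) as [X5 HX5]; [lra|].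
  assert (B1 := HX4 (Rmax X4 X5) (Rmax_l _ _)).
  assert (B2 := HX5 (Rmax X4 X5) (Rmax_r _ _)).
  apply Rabs_def2 in B2. lra.
Qed.

(** * Complex primitives and solutions of the differential equation *)

Definition ccont_from (a : R) (f : R -> Cplx) : Prop :=
  forall x, clim (locally x) (fun t => f (Rmax a t)) (f (Rmax a x)).

Definition cprimitive_from (a : R) (f F : R -> Cplx) : Prop :=
  forall x, a <= x -> is_cgint f a x (Csub (F x) (F a)).

Lemma cprimitive_fromP a f F : cprimitive_from a f F <->
  primitive_from a (fun t => fst (f t)) (fun t => fst (F t)) /\
  primitive_from a (fun t => snd (f t)) (fun t => snd (F t)).
Proof.
  split.
  - intros H; split; intros x Hx; apply (H x Hx).
  - intros [H1 H2] x Hx; split; [apply (H1 x Hx)|apply (H2 x Hx)].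
Qed.

Lemma cprimitive_from_weaken a b f F :
  cprimitive_from a f F -> a <= b -> cprimitive_from b f F.
Proof.
  rewrite !cprimitive_fromP. intros [H1 H2] Hab.
  split; eapply primitive_from_weaken; eauto.
Qed.

Lemma cprimitive_from_continuous a f F : cprimitive_from a f F -> ccont_from a F.
Proof.
  rewrite cprimitive_fromP. intros [H1 H2] x.
  split; [apply (primitive_from_continuous _ _ _ H1)|apply (primitive_from_continuous _ _ _ H2)].
Qed.

Lemma cprimitive_from_derive a f F x :
  cprimitive_from a f F -> ccont_from a f -> a < x -> cderive F x (f x).
Proof.
  rewrite cprimitive_fromP. intros [H1 H2] Hc Hx.
  split; [apply (primitive_from_derive a _ _ x H1)|apply (primitive_from_derive a _ _ x H2)]; auto;
    intros t; apply (Hc t).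
Qed.

Lemma cgint_correct f a b I : is_cgint f a b I -> is_cgint f a b (cgint f a b).
Proof. intros H. unfold cgint. apply epsilon_spec. eauto. Qed.

Lemma cgint_primitive a f :
  (forall x, a <= x -> exists I, is_cgint f a x I) -> cprimitive_from a f (cgint f a).
Proof.
  intros H x Hx.
  assert (K : forall y, a <= y -> is_cgint f a y (cgint f a y)).
  { intros y Hy. destruct (H y Hy) as [I HI]. eapply cgint_correct; eauto. }
  assert (K0 : cgint f a a = Czero).
  { destruct (K a (Rle_refl a)) as [K1 K2].
    apply Cplx_ext; [apply (is_gint_refl_0 _ _ _ K1)|apply (is_gint_refl_0 _ _ _ K2)]. }
  replace (Csub (cgint f a x) (cgint f a a)) with (cgint f a x) by (rewrite K0; ring).
  auto.
Qed.

Lemma ccont_from_ex_cgint a f :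
  ccont_from a f -> forall x, a <= x -> exists I, is_cgint f a x I.
Proof.
  intros H x Hx.
  destruct (cont_from_ex_primitive a (fun t => fst (f t))) as [F1 H1]; [intros t; apply (H t)|].
  destruct (cont_from_ex_primitive a (fun t => snd (f t))) as [F2 H2]; [intros t; apply (H t)|].
  exists (F1 x - F1 a, F2 x - F2 a). split; [apply H1|apply H2]; auto.
Qed.

Lemma ex_cgint_initial f a x y J :
  a <= x <= y -> is_cgint f a y J -> exists I, is_cgint f a x I.
Proof.
  intros Hxy [H1 H2].
  destruct (ex_gint_initial _ _ _ _ _ Hxy H1) as [I1 HI1].
  destruct (ex_gint_initial _ _ _ _ _ Hxy H2) as [I2 HI2].
  exists (I1, I2). now split.
Qed.

Lemma SL_sol_continuous p q z y y1 :
  SL_sol p q z y y1 -> ccont_from 0 y /\ ccont_from 0 y1.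
Proof.
  intros H.
  split; eapply cprimitive_from_continuous; intros x Hx; apply (H x Hx).
Qed.

Lemma cont_from_inv a p :
  (forall x, a <= x -> 0 < p x) -> cont_from a p -> cont_from a (fun t => / p t).
Proof.
  intros Hp Hc x. apply rlim_inv; [|apply Hc].
  assert (0 < p (Rmax a x)); [|lra]. apply Hp, Rmax_l.
Qed.

Lemma SL_sol_flux_continuous p q z y y1 :
  (forall x, 0 <= x -> 0 < p x) -> cont_from 0 p -> SL_sol p q z y y1 ->
  ccont_from 0 (fun t => Cscal (/ p t) (y1 t)).
Proof.
  intros Hp Hc H x. apply clim_scal; [apply cont_from_inv; auto|].
  apply (SL_sol_continuous _ _ _ _ _ H).
Qed.

Lemma SL_sol_derive p q z y y1 x :
  (forall x, 0 <= x -> 0 < p x) -> cont_from 0 p -> SL_sol p q z y y1 -> 0 < x ->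
  cderive y x (Cscal (/ p x) (y1 x)).
Proof.
  intros Hp Hc H Hx.
  apply (cprimitive_from_derive 0 (fun t => Cscal (/ p t) (y1 t))); auto.
  - intros t Ht. apply (H t Ht).
  - eapply SL_sol_flux_continuous; eauto.
Qed.

Lemma ccont_from_weaken a b f : a <= b -> ccont_from a f -> ccont_from b f.
Proof.
  intros Hab H x.
  split; [apply (cont_from_weaken a b (fun t => fst (f t)) Hab)
         |apply (cont_from_weaken a b (fun t => snd (f t)) Hab)]; intros t; apply (H t).
Qed.

Lemma SL_sol_derive_flux p q z y y1 x0 x :
  0 <= x0 -> cont_from x0 q -> SL_sol p q z y y1 -> x0 < x ->
  cderive y1 x (Cmul (Csub (RtoC (q x)) z) (y x)).
Proof.
  intros Hx0 Hq H Hx.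
  apply (cprimitive_from_derive x0 (fun t => Cmul (Csub (RtoC (q t)) z) (y t))); auto.
  - apply cprimitive_from_weaken with 0; auto. intros t Ht. apply (H t Ht).
  - intros t. apply clim_mul.
    + apply clim_sub; [|apply clim_const]. apply clim_RtoC. apply Hq.
    + apply (ccont_from_weaken 0); auto. apply (SL_sol_continuous _ _ _ _ _ H).
Qed.

(* On [0, x0] the flux is only a gauge primitive, so this uses [primitive_from_mult]
   rather than differentiation. *)
Lemma wronsk_constant p q z y y1 u u1 x :
  (forall x, 0 <= x -> 0 < p x) -> cont_from 0 p ->
  SL_sol p q z y y1 -> SL_sol p q z u u1 -> 0 <= x ->
  wronsk y y1 u u1 x = wronsk y y1 u u1 0.
Proof.
  intros Hp Hc Hy Hu Hx.
  assert (Cy := SL_sol_flux_continuous p q z y y1 Hp Hc Hy).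
  assert (Cu := SL_sol_flux_continuous p q z u u1 Hp Hc Hu).
  assert (Py : cprimitive_from 0 (fun t => Cscal (/ p t) (y1 t)) y) by (intros t Ht; apply (Hy t Ht)).
  assert (Pu : cprimitive_from 0 (fun t => Cscal (/ p t) (u1 t)) u) by (intros t Ht; apply (Hu t Ht)).
  assert (Py1 : cprimitive_from 0 (fun t => Cmul (Csub (RtoC (q t)) z) (y t)) y1)
    by (intros t Ht; apply (Hy t Ht)).
  assert (Pu1 : cprimitive_from 0 (fun t => Cmul (Csub (RtoC (q t)) z) (u t)) u1)
    by (intros t Ht; apply (Hu t Ht)).
  rewrite cprimitive_fromP in Py, Pu, Py1, Pu1.
  destruct Py as [Pyr Pyi], Pu as [Pur Pui], Py1 as [Py1r Py1i], Pu1 as [Pu1r Pu1i].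
  assert (Cyr : cont_from 0 (fun t => fst (Cscal (/ p t) (y1 t)))) by (intros t; apply (Cy t)).
  assert (Cyi : cont_from 0 (fun t => snd (Cscal (/ p t) (y1 t)))) by (intros t; apply (Cy t)).
  assert (Cur : cont_from 0 (fun t => fst (Cscal (/ p t) (u1 t)))) by (intros t; apply (Cu t)).
  assert (Cui : cont_from 0 (fun t => snd (Cscal (/ p t) (u1 t)))) by (intros t; apply (Cu t)).
  assert (Hzero : forall f a b I, (forall t, f t = 0) -> is_gint f a b I -> I = 0).
  { intros f a b I Hf HI. apply is_gint_bound with (m := 0) (M := 0) in HI; [lra|].
    intros t _. rewrite Hf. lra. }
  (* The real part of the Wronskian is a signed sum of four real products, each handled by the
     product rule. In the combined integrand the terms with q - z and those with 1 / p cancel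
     pointwise, so the integral is zero. The imaginary part is treated alike. *)
  assert (Hre : fst (wronsk y y1 u u1 x) - fst (wronsk y y1 u u1 0) = 0).
  { assert (K1 := primitive_from_mult _ _ _ _ _ Py1r Pur Cur x Hx).
    assert (K2 := primitive_from_mult _ _ _ _ _ Py1i Pui Cui x Hx).
    assert (K3 := primitive_from_mult _ _ _ _ _ Pu1r Pyr Cyr x Hx).
    assert (K4 := primitive_from_mult _ _ _ _ _ Pu1i Pyi Cyi x Hx).
    assert (K := is_gint_plus _ _ _ _ _ _ (is_gint_plus _ _ _ _ _ _ K1 (is_gint_opp _ _ _ _ K2))
                   (is_gint_plus _ _ _ _ _ _ (is_gint_opp _ _ _ _ K3) K4)).
    apply Hzero in K; [|intros t; simpl; ring].
    eapply eq_trans; [|exact K]. simpl. ring. }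
  assert (Him : snd (wronsk y y1 u u1 x) - snd (wronsk y y1 u u1 0) = 0).
  { assert (K1 := primitive_from_mult _ _ _ _ _ Py1r Pui Cui x Hx).
    assert (K2 := primitive_from_mult _ _ _ _ _ Py1i Pur Cur x Hx).
    assert (K3 := primitive_from_mult _ _ _ _ _ Pu1r Pyi Cyi x Hx).
    assert (K4 := primitive_from_mult _ _ _ _ _ Pu1i Pyr Cyr x Hx).
    assert (K := is_gint_plus _ _ _ _ _ _ (is_gint_plus _ _ _ _ _ _ K1 K2)
                   (is_gint_opp _ _ _ _ (is_gint_plus _ _ _ _ _ _ K3 K4))).
    apply Hzero in K; [|intros t; simpl; ring].
    eapply eq_trans; [|exact K]. simpl. ring. }
  apply Cplx_ext; lra.
Qed.

(* [sg] is the sign of the imaginary part; fixing it makes the root continuous everywhere. *)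
Definition csqrt_branch (sg : R) (u : Cplx) : Cplx :=
  (sqrt ((Cnorm u + fst u) / 2), sg * sqrt ((Cnorm u - fst u) / 2)).

Lemma clim_csqrt_branch F (FF : Filter F) sg f l :
  clim F f l -> clim F (fun t => csqrt_branch sg (f t)) (csqrt_branch sg l).
Proof.
  intros [H1 H2].
  assert (HN : filterlim (fun t => Cnorm (f t)) F (locally (Cnorm l))).
  { apply rlim_sqrt. apply rlim_plus; apply rlim_sqr; auto. }
  split; simpl.
  - apply rlim_sqrt. apply rlim_mult; [|apply rlim_const]. apply rlim_plus; auto.
  - apply rlim_mult; [apply rlim_const|].
    apply rlim_sqrt. apply rlim_mult; [|apply rlim_const]. apply rlim_plus; auto.
    now apply rlim_opp.
Qed.

Lemma Cnorm_scal r a : 0 <= r -> Cnorm (Cscal r a) = r * Cnorm a.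
Proof.
  intros Hr. rewrite Cscal_RtoC, Cnorm_mul. f_equal.
  unfold Cnorm; simpl. replace (r * (r * 1) + 0 * (0 * 1)) with (Rsqr r) by (unfold Rsqr; ring).
  now apply sqrt_Rsqr.
Qed.

(** Applied with r = p0 to -z / p0, this gives sqrt(-p0 z) = p0 sqrt(-z / p0) on one branch. *)
Lemma csqrt_branch_scal sg r u :
  0 <= r -> csqrt_branch sg (Cscal (r * r) u) = Cscal r (csqrt_branch sg u).
Proof.
  intros Hr. assert (Hrr : 0 <= r * r) by nra.
  assert (E : forall c, sqrt (r * r * c) = r * sqrt c).
  { intros c. rewrite sqrt_mult_alt, sqrt_square; auto. }
  unfold csqrt_branch. rewrite (Cnorm_scal (r * r) u) by auto. unfold Cscal; simpl.
  replace ((r * r * Cnorm u + r * r * fst u) / 2) with (r * r * ((Cnorm u + fst u) / 2)) by field.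
  replace ((r * r * Cnorm u - r * r * fst u) / 2) with (r * r * ((Cnorm u - fst u) / 2)) by field.
  rewrite !E. f_equal. ring.
Qed.

Lemma csqrt_branch_re_pos sg u :
  ~ (snd u = 0 /\ fst u <= 0) -> 0 < fst (csqrt_branch sg u).
Proof.
  intros H. simpl. apply sqrt_lt_R0. apply Rdiv_lt_0_compat; [|lra].
  assert (K := Rabs_fst_le_Cnorm u).
  destruct (Rlt_le_dec 0 (fst u)) as [Hu|Hu].
  - assert (P := Cnorm_pos u). lra.
  - assert (Hs : snd u <> 0) by tauto.
    assert (Hn : Rabs (fst u) < Cnorm u).
    { unfold Cnorm. rewrite <- sqrt_Rsqr_abs. apply sqrt_lt_1_alt. unfold Rsqr.
      assert (0 < snd u * snd u) by nra. split; nra. }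
    rewrite Rabs_left1 in Hn; lra.
Qed.

(** The imaginary part of (q - z) / p is -Im z / p, whose sign does not depend on x and agrees with
    that of Im(-r z). If z is real, it is negative, so q - z >= 0 for large x: the argument has left
    the cut, and both boundary values give the principal root. *)
Lemma omega_branch b p q z :
  ~ (Cim z = 0 /\ 0 <= Cre z) -> (forall x, 0 <= x -> 0 < p x) -> tends_to_inf q 0 ->
  exists sg, (forall r, 0 < r -> Csqrt (Cscal (- r) z) = csqrt_branch sg (Cscal (- r) z)) /\
    exists X, 0 <= X /\ forall x, X <= x ->
      omega b p q z x = csqrt_branch sg (Cscal (/ p x) (Csub (RtoC (q x)) z)).
Proof.
  intros Hz Hp Hq. unfold Cim, Cre in Hz.
  assert (Hbr : forall sg u, (snd u < 0 -> sg = -1) -> (0 <= snd u -> sg = 1) ->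
             Csqrt u = csqrt_branch sg u).
  { intros sg u H1 H2. unfold Csqrt, csqrt_branch. f_equal.
    destruct (Rlt_dec (snd u) 0) as [H|H].
    - rewrite H1 by auto. ring.
    - rewrite H2 by lra. ring. }
  assert (Hbv : forall u, ~ (snd u = 0 /\ fst u < 0) -> Csqrt_bv b u = Csqrt u).
  { intros u Hu. unfold Csqrt_bv. destruct Rlt_dec; auto. destruct Req_EM_T; auto. tauto. }
  exists (if Rlt_dec 0 (snd z) then -1 else 1). split.
  - intros r Hr. apply Hbr; simpl; destruct Rlt_dec as [H|H]; auto; intros; nra.
  - assert (HX : exists X, 0 <= X /\ forall x, X <= x -> snd z = 0 -> 0 <= q x - fst z).
    { destruct (Req_dec (snd z) 0) as [E|E].
      - assert (Hz' : 0 < - fst z) by (apply Rnot_le_lt; intros K; apply Hz; split; [auto|lra]).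
        destruct (Hq _ Hz') as [X HX]. exists (Rmax 0 X). split; [apply Rmax_l|].
        intros x Hx _. assert (K := Rmax_r 0 X). assert (B : X <= x) by lra.
        specialize (HX x B). apply Rabs_def2 in HX. lra.
      - exists 0; split; [lra|tauto]. }
    destruct HX as [X [HX0 HX]]. exists X; split; auto. intros x Hx.
    assert (Hpx : 0 < p x) by (apply Hp; lra).
    assert (Hip := Rinv_0_lt_compat _ Hpx).
    unfold omega. rewrite Hbv.
    + apply Hbr; simpl; destruct Rlt_dec as [H|H]; auto; intros; nra.
    + simpl. intros [E1 E2].
      assert (E : snd z = 0) by nra. specialize (HX x Hx E). nra.
Qed.

(** * The chosen integral in [afun] and the Jost asymptotics *)

(** If the integral up to x1 does not exist, neither does one up to any later x. The two predicates
    passed to [epsilon] are then both false everywhere, hence equal by extensionality, and the same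
    default value is chosen. *)
Lemma cgint_undefined_constant f a x1 :
  a <= x1 -> ~ (exists I, is_cgint f a x1 I) ->
  forall x, x1 <= x -> cgint f a x = cgint f a x1.
Proof.
  intros Hax H x Hx. unfold cgint. f_equal.
  apply functional_extensionality. intros I. apply propositional_extensionality.
  split; intros HI; exfalso; apply H; eauto.
  eapply ex_cgint_initial; [|exact HI]. lra.
Qed.

Lemma jost_ratio_limit b p q pd qd x0 z theta :
  0 <= x0 -> L1_from pd 0 -> L1_from qd x0 -> jost_asymp b p q pd qd z theta ->
  clim (Rbar_locally p_infty) (fun x => Cmul (theta x) (Cinv (afun b p q z x))) Cone.
Proof.
  intros Hx0 Hpd Hqd [K [X H]].
  apply Ctends_to_infP. intros e He.
  (* The constant [K] comes without a sign, and |K| + 1 is a positive bound for it. *)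
  destruct (epsf_tends_to_0 pd qd x0 Hx0 Hpd Hqd (e / (Rabs K + 1))) as [Y HY].
  { apply Rdiv_lt_0_compat; auto. assert (P := Rabs_pos K); lra. }
  exists (Rmax X Y). intros x Hx.
  assert (Hm1 := Rmax_l X Y). assert (Hm2 := Rmax_r X Y).
  assert (BX : X <= x) by lra. assert (BY : Y <= x) by lra.
  specialize (H x BX). specialize (HY x BY). rewrite Rminus_0_r in HY.
  set (a := afun b p q z x) in *.
  assert (Ha : a <> Czero) by apply Cexp_neq0.
  assert (Hn := Cnorm_gt0 a Ha).
  apply (Rmult_lt_reg_r (Cnorm a)); auto. rewrite <- Cnorm_mul.
  replace (Cmul (Csub (Cmul (theta x) (Cinv a)) Cone) a) with (Csub (theta x) a) by (field; auto).
  eapply Rle_lt_trans; [exact H|]. apply Rmult_lt_compat_r; auto.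
  assert (P := Rabs_pos K).
  apply Rle_lt_trans with (Rabs (K * epsf pd qd x)); [apply Rle_abs|].
  rewrite Rabs_mult.
  apply Rle_lt_trans with ((Rabs K + 1) * Rabs (epsf pd qd x)).
  { apply Rmult_le_compat_r; [apply Rabs_pos|lra]. }
  apply Rlt_le_trans with ((Rabs K + 1) * (e / (Rabs K + 1))).
  - apply Rmult_lt_compat_l; lra.
  - right; field; lra.
Qed.

Lemma locally_ge X x : X < x -> locally x (fun t => X <= t).
Proof.
  intros Hx. assert (Hp : 0 < x - X) by lra. exists (mkposreal _ Hp). intros t Ht.
  unfold ball in Ht; simpl in Ht; unfold AbsRing_ball, abs, minus, plus, opp in Ht; simpl in Ht.
  apply Rabs_def2 in Ht. lra.
Qed.

Theorem theorem3p5
  (p q pd qd : R -> R) (p0 x0 : R) (z : Cplx) (b : bool)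
  (phi phi1 theta theta1 : R -> Cplx) :
  (* Assumption A *)
  (forall x, 0 <= x -> 0 < p x) ->
  (forall x, 0 <= x -> is_gint pd 0 x (p x - p 0)) ->
  L1_from pd 0 ->
  0 < p0 -> tends_to_inf p p0 ->
  0 < x0 ->
  (exists I, is_gint q 0 x0 I) ->
  (exists I, is_gint (fun t => Rabs (q t)) 0 x0 I) ->
  (forall x, x0 <= x -> is_gint qd x0 x (q x - q x0)) ->
  L1_from qd x0 ->
  tends_to_inf q 0 ->
  (* z in C \ [0, oo) *)
  ~ (Cim z = 0 /\ 0 <= Cre z) ->
  (* regular solution *)
  SL_sol p q z phi phi1 -> phi 0 = Czero -> phi1 0 = RtoC (p 0) ->
  (* modified Jost solution *)
  SL_sol p q z theta theta1 -> jost_asymp b p q pd qd z theta ->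
  let w := wronsk phi phi1 theta theta1 0 in
  let a := afun b p q z in
  (w <> Czero ->
     exists r : R -> Cplx, Ctends_to_inf r Czero /\
       exists X, forall x, X <= x ->
         phi x = Cmul (Cmul (Cmul w (Cinv (Cscal 2 (Csqrt (Cscal (- p0) z)))))
                            (Cinv (a x))) (Cadd Cone (r x)))
  /\
  (w = Czero ->
     forall (rho : R) (xi xi1 : R -> Cplx),
       0 <= rho ->
       (forall x, rho <= x -> theta x <> Czero) ->
       SL_sol p q z xi xi1 ->
       (forall x, rho <= x ->
          xi x = Cmul (theta x)
                   (cgint (fun y => Cscal (/ p y) (Cinv (Cmul (theta y) (theta y)))) rho x)) ->
       exists r : R -> Cplx, Ctends_to_inf r Czero /\
         exists X, forall x, X <= x ->
           phi x = Cmul (Cmul (Copp (wronsk phi phi1 xi xi1 0)) (a x)) (Cadd Cone (r x))).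
Proof.
  intros Hp Hpd HpdL Hp0 Hplim Hx0 _ _ Hqd HqdL Hqlim Hz Sphi _ _ Sth Hjost w a.
  assert (Cp : cont_from 0 p).
  { apply (primitive_from_continuous 0 pd). exact Hpd. }
  assert (Cq : cont_from x0 q).
  { apply (primitive_from_continuous x0 qd). exact Hqd. }
  assert (Hz0 : z <> Czero).
  { intros E. apply Hz. rewrite E. unfold Cim, Cre; simpl. lra. }
  assert (HT : clim (Rbar_locally p_infty) (fun x => Cmul (theta x) (Cinv (a x))) Cone).
  { apply (jost_ratio_limit b p q pd qd x0); auto; lra. }
  assert (Ha : forall x, a x <> Czero) by (intros x; apply Cexp_neq0).
  (* If omega were not integrable, [cgint] would be a constant junk value and theta would
     have a nonzero limit, which the differential equation forbids. *)
  assert (Hint : forall x, 0 <= x -> exists I, is_cgint (omega b p q z) 0 x I).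
  { intros x1 Hx1. apply NNPP. intros HN.
    apply (no_solution_with_nonzero_limit theta theta1 p q p0 z (a x1) (x0 + 1)); auto.
    - intros x Hx. apply (SL_sol_derive p q z); auto; lra.
    - intros x Hx. apply (SL_sol_derive_flux p q z) with x0; auto; lra.
    - intros x Hx. apply Hp; lra.
    - apply clim_ext with (fun x => Cmul (Cmul (theta x) (Cinv (a x))) (a x1)).
      + eapply filter_imp; [|apply (at_infty_ge x1)]. intros x Hx.
        replace (a x1) with (a x); [field; auto|].
        unfold a, afun. now rewrite (cgint_undefined_constant _ 0 x1 Hx1 HN x Hx).
      + apply clim_eq with (Cmul Cone (a x1)); [|ring].
        apply clim_mul; [exact HT|apply clim_const]. }
  assert (HOm := cgint_primitive 0 _ Hint).
  destruct (omega_branch b p q z Hz Hp Hqlim) as [sg [Hsq [X1 [HX1 Hom]]]].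
  set (om_inf := csqrt_branch sg (Cscal (/ p0) (Csub (RtoC 0) z))).
  assert (Hompos : 0 < fst om_inf).
  { apply csqrt_branch_re_pos. assert (Hip := Rinv_0_lt_compat _ Hp0).
    unfold Cim, Cre in Hz. simpl. intros [E1 E2]. apply Hz. split; nra. }
  assert (Hsqrt : Csqrt (Cscal (- p0) z) = Cmul (RtoC p0) om_inf).
  { rewrite Hsq by auto. rewrite <- Cscal_RtoC. unfold om_inf.
    rewrite <- csqrt_branch_scal by lra. f_equal.
    apply Cplx_ext; simpl; field; lra. }
  assert (Homlim : clim (Rbar_locally p_infty) (omega b p q z) om_inf).
  { apply clim_ext with (fun x => csqrt_branch sg (Cscal (/ p x) (Csub (RtoC (q x)) z))).
    - eapply filter_imp; [|apply (at_infty_ge X1)]. intros x Hx. now rewrite Hom.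
    - apply clim_csqrt_branch; [apply Rbar_locally_filter|]. apply clim_scal.
      + apply rlim_inv; [lra|]. now apply tends_to_infP.
      + apply clim_sub; [|apply clim_const]. apply clim_RtoC. now apply tends_to_infP. }
  (* Beyond [X2] the coefficient q is continuous and the branch formula holds, so [omega] is
     continuous there. The integral in [a] starts at 0 but is differentiated only past [X2], after a
     change of base point. *)
  set (X2 := Rmax x0 X1).
  assert (HX2a : x0 <= X2) by apply Rmax_l. assert (HX2b : X1 <= X2) by apply Rmax_r.
  assert (Comega : ccont_from X2 (omega b p q z)).
  { intros x. rewrite (Hom (Rmax X2 x)) by (assert (K := Rmax_l X2 x); lra).
    apply clim_ext with
      (fun t => csqrt_branch sg (Cscal (/ p (Rmax X2 t)) (Csub (RtoC (q (Rmax X2 t))) z))).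
    - apply filter_forall. intros t. rewrite Hom; auto. assert (K := Rmax_l X2 t). lra.
    - apply clim_csqrt_branch; [apply locally_filter|]. apply clim_scal.
      + apply (cont_from_inv X2); [intros; apply Hp; lra|]. apply (cont_from_weaken 0); auto; lra.
      + apply clim_sub; [|apply clim_const]. apply clim_RtoC. apply (cont_from_weaken x0); auto. }
  assert (Da : forall x, X2 < x -> cderive a x (Copp (Cmul (omega b p q z x) (a x)))).
  { intros x Hx. eapply cderive_eq.
    - apply (cderive_exp (fun t => Copp (cgint (omega b p q z) 0 t))).
      apply cderive_opp. apply (cprimitive_from_derive X2 (omega b p q z)); auto.
      apply cprimitive_from_weaken with 0; auto; lra.
    - fold (afun b p q z x) (a x). unfold a, afun. ring. }
  (* A zero of [theta] would put theta / a at distance 1 from its limit. *)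
  assert (HX3 : exists X3, X2 < X3 /\ forall x, X3 <= x -> theta x <> Czero).
  { apply Ctends_to_infP in HT. destruct (HT 1) as [Y HY]; [lra|].
    exists (Rmax (X2 + 1) Y). assert (Hm1 := Rmax_l (X2 + 1) Y). assert (Hm2 := Rmax_r (X2 + 1) Y).
    split; [lra|]. intros x Hx E. assert (B : Y <= x) by lra. specialize (HY x B).
    rewrite E in HY.
    replace (Csub (Cmul Czero (Cinv (a x))) Cone) with (Copp Cone) in HY by ring.
    assert (K := Rabs_fst_le_Cnorm (Copp Cone)). simpl in K.
    rewrite Rabs_Ropp, Rabs_R1 in K. lra. }
  destruct HX3 as [X3 [HX23 Hth]].
  assert (Hpn : forall x, X3 <= x -> p x <> 0).
  { intros x Hx. assert (0 < p x) by (apply Hp; lra). lra. }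
  assert (Dphi : forall x, X3 <= x -> cderive phi x (Cscal (/ p x) (phi1 x))).
  { intros x Hx. apply (SL_sol_derive p q z); auto; lra. }
  assert (Dth : forall x, X3 <= x -> cderive theta x (Cscal (/ p x) (theta1 x))).
  { intros x Hx. apply (SL_sol_derive p q z); auto; lra. }
  assert (Hw : forall x, X3 <= x -> wronsk phi phi1 theta theta1 x = w).
  { intros x Hx. apply (wronsk_constant p q z); auto; lra. }
  split.
  - intros Hw0.
    set (S := Cscal 2 (Csqrt (Cscal (- p0) z))).
    assert (HS : S <> Czero).
    { unfold S. rewrite Cscal_RtoC, Hsqrt. repeat apply Cmul_neq0.
      - apply RtoC_neq0; lra.
      - apply RtoC_neq0; lra.
      - intros E. rewrite E in Hompos. simpl in Hompos. lra. }
    assert (Hlim : clim (Rbar_locally p_infty) (fun x => Cmul (phi x) (a x)) (Cmul w (Cinv S))).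
    { unfold S. rewrite Hsqrt.
      apply (growing_solution_limit a (omega b p q z) phi phi1 theta theta1 p p0 om_inf w X3); auto.
      intros x Hx. apply Da; lra. }
    (* This r is the relative error solved from the claimed identity, so the identity holds at every
       x and only the limit of r carries content. *)
    exists (fun x => Csub (Cmul (Cmul (phi x) (a x)) (Cmul S (Cinv w))) Cone). split.
    + apply Ctends_to_infP.
      eapply clim_eq.
      * apply clim_sub; [|apply clim_const]. apply clim_mul; [exact Hlim|apply clim_const].
      * field. auto.
    + exists 0. intros x _. field. auto.
  - intros Hw0 rho xi xi1 Hrho Hthrho Sxi Hxi.
    exists (fun x => Csub (Cmul (theta x) (Cinv (a x))) Cone). split.
    { apply Ctends_to_infP. apply clim_eq with (Csub Cone Cone); [|ring].
      apply clim_sub; [exact HT|apply clim_const]. }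
    set (g := fun y => Cscal (/ p y) (Cinv (Cmul (theta y) (theta y)))).
    assert (Cg : ccont_from rho g).
    { intros x.
      assert (Ct : clim (locally x) (fun t => theta (Rmax rho t)) (theta (Rmax rho x))).
      { apply (ccont_from_weaken 0); auto. apply (SL_sol_continuous _ _ _ _ _ Sth). }
      apply clim_scal.
      - apply (cont_from_inv rho); [intros; apply Hp; lra|]. apply (cont_from_weaken 0); auto.
      - apply clim_inv; [|apply clim_mul; exact Ct].
        apply Cmul_neq0; apply Hthrho, Rmax_l. }
    assert (HJ := cgint_primitive rho g (ccont_from_ex_cgint rho g Cg)).
    (* One point suffices, since Wronskians are constant. The added 1 puts it strictly inside both
       half-lines, where neighbourhoods are available for differentiation. *)
    set (x := Rmax rho X3 + 1).
    assert (Hm1 := Rmax_l rho X3). assert (Hm2 := Rmax_r rho X3).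
    assert (Hxr : rho < x) by (unfold x; lra). assert (Hx3 : X3 < x) by (unfold x; lra).
    assert (Htx : theta x <> Czero) by (apply Hth; lra).
    assert (Hpx : RtoC (p x) <> Czero) by (apply RtoC_neq0, Hpn; lra).
    (* The derivative of xi / theta is computed from the Wronskian and from the integral formula.
       Uniqueness of derivatives leaves the value 1. *)
    assert (Wxi : wronsk xi xi1 theta theta1 x = Cone).
    { assert (D1 : cderive (fun t => Cmul (xi t) (Cinv (theta t))) x
         (Cmul (wronsk xi xi1 theta theta1 x) (Cinv (Cmul (RtoC (p x)) (Cmul (theta x) (theta x)))))).
      { apply quotient_cderive; auto; [apply Hpn; lra| |apply Dth; lra].
        apply (SL_sol_derive p q z); auto; lra. }
      assert (D2 : cderive (fun t => Cmul (xi t) (Cinv (theta t))) x (g x)).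
      { apply cderive_ext with (cgint g rho).
        - eapply filter_imp; [|apply (locally_ge rho x Hxr)]. intros t Ht.
          rewrite Hxi by auto. fold g. field. auto.
        - apply (cprimitive_from_derive rho g); auto. }
      assert (E := cderive_unique _ _ _ _ D1 D2). unfold g in E.
      rewrite Cscal_RtoC, RtoC_inv in E by (apply Hpn; lra).
      set (W := wronsk xi xi1 theta theta1 x) in *.
      transitivity (Cmul (Cmul W (Cinv (Cmul (RtoC (p x)) (Cmul (theta x) (theta x)))))
         (Cmul (RtoC (p x)) (Cmul (theta x) (theta x)))); [field; auto|].
      rewrite E. field. auto. }
    set (C := Cmul (phi X3) (Cinv (theta X3))).
    assert (Hphi : forall t, X3 <= t -> phi t = Cmul C (theta t)).
    { intros t Ht.
      assert (E : Cmul (phi t) (Cinv (theta t)) = C).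
      { apply (cderive_0_const (fun t => Cmul (phi t) (Cinv (theta t))) X3 t Ht).
        intros s Hs. eapply cderive_eq.
        - apply (quotient_cderive phi phi1 theta theta1 p);
            [apply Hpn|apply Hth|apply Dphi|apply Dth]; lra.
        - rewrite Hw, Hw0 by lra. ring. }
      rewrite <- E. field. apply Hth; auto. }
    (* The Wronskian with [xi] involves the flux of [phi], so proportionality to [theta] is carried
       over to the fluxes by differentiating it at [x]. *)
    assert (Hphi1 : phi1 x = Cmul C (theta1 x)).
    { assert (D1 : cderive phi x (Cscal (/ p x) (phi1 x))) by (apply Dphi; lra).
      assert (D2 : cderive phi x (Cmul C (Cscal (/ p x) (theta1 x)))).
      { apply cderive_ext with (fun t => Cmul C (theta t)).
        - eapply filter_imp; [|apply (locally_ge X3 x Hx3)]. intros t Ht. now rewrite Hphi.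
        - eapply cderive_eq; [apply (cderive_mul (fun _ => C) theta);
            [apply cderive_const|apply Dth; lra]|]. cbv beta. ring. }
      assert (E := cderive_unique _ _ _ _ D1 D2).
      rewrite !Cscal_RtoC, RtoC_inv in E by (apply Hpn; lra).
      transitivity (Cmul (RtoC (p x)) (Cmul (Cinv (RtoC (p x))) (phi1 x))); [field; auto|].
      rewrite E. field. auto. }
    (* By antisymmetry, -{phi, xi} = -C {theta, xi} = C {xi, theta}, evaluated at [x] and moved to 0
       by constancy. *)
    assert (HC : Copp (wronsk phi phi1 xi xi1 0) = C).
    { rewrite <- (wronsk_constant p q z phi phi1 xi xi1 x) by (auto; lra).
      transitivity (Cmul C (wronsk xi xi1 theta theta1 x)).
      - unfold wronsk. rewrite Hphi1, Hphi by lra. ring.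
      - rewrite Wxi. ring. }
    exists X3. intros t Ht. rewrite HC, Hphi by auto. field. auto.
Qed.
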